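(* Let $X\subset\mathbb{R}^n$ be a closed definable curve (a closed definable set of dimension $1$) with $0\in \mathrm{Sng}_2X\cap \mathrm{Reg}_1X$. If $0\in\overline{M_X}$, then $0\in\mathcal{SQ}(X)$, i.e. $X$ is superquadratic at $0$.
   Context: Fix an o-minimal structure expanding the field $\mathbb{R}$; ''definable'' means definable in it. $\mathbb{R}^n$ carries the Euclidean norm. For a closed nonempty $X\subset\mathbb{R}^n$ and $a\in\mathbb{R}^n$ put $d(a,X)=\inf\{\|a-x\| : x\in X\}$ and $m(a)=\{x\in X : \|a-x\|=d(a,X)\}$. The medial axis of $X$ is $M_X=\{a\in\mathbb{R}^n : \#m(a)>1\}$, and $\overline{M_X}$ is its closure in $\mathbb{R}^n$. $\mathrm{Reg}_kX$ is the set of points $x\in X$ having a neighbourhood $U$ in $\mathbb{R}^n$ such that $X\cap U$ is a $\mathscr{C}^k$-submanifold of $\mathbb{R}^n$ (without boundary); $\mathrm{Sng}_kX=X\setminus \mathrm{Reg}_kX$. Superquadracity: let $X\subset\mathbb{R}^n$ be closed and definable, $a\in \mathrm{Sng}_2X\cap \mathrm{Reg}_1X$, and let $p$ be the orthogonal projection onto the affine tangent space $a+T_aX$. For a sufficiently small closed ball $U$ centred at $a$ put $g(\varepsilon)=\max\{\|x-p(x)\| : x\in X\cap U,\ \|p(x)-a\|=\varepsilon\}$ for small $\varepsilon>0$ (for $\varepsilon$ small enough the value does not depend on the choice of small $U$). $X$ is superquadratic at $a$ if $\lim_{\varepsilon\to0^+}g(\varepsilon)/\varepsilon^2=+\infty$.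 $\mathcal{SQ}(X)$ is the set of all points of $X$ at which $X$ is superquadratic. *)

(* Defs.v *)
From HB Require Import structures.
From mathcomp Require Import all_boot all_order all_algebra.
From mathcomp Require Import all_classical all_reals all_analysis.

Set Implicit Arguments.
Unset Strict Implicit.
Unset Printing Implicit Defensive.

Import Order.TTheory GRing.Theory Num.Theory.
Import numFieldNormedType.Exports.

Local Open Scope classical_set_scope.
Local Open Scope ring_scope.

(* [S n] is the collection of definable subsets of R^n. Parameters from R are
   allowed ([omin_point]); the order of R is definable from + and *. The sets
   [set` i], i : interval R, include points, rays and the whole line. *)
Record o_minimal_structure (R : realType) (S : forall n, set (set 'rV[R]_n))
    : Prop := {
  omin_setT : forall n, S n setT;
  omin_setC : forall n A, S n A -> S n (~` A);
  omin_setU : forall n A B, S n A -> S n B -> S n (A `|` B);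
  omin_prod : forall m n A B, S m A -> S n B ->
    S (m + n)%N [set z | A (lsubmx z) /\ B (rsubmx z)];
  omin_diag : forall n (i j : 'I_n), S n [set x : 'rV[R]_n | x 0 i = x 0 j];
  omin_proj : forall m n A, S (m + n)%N A -> S m (lsubmx @` A);
  omin_point : forall c : R, S 1%N [set const_mx c];
  omin_add : S 3 [set x : 'rV[R]_3 | x 0 0 + x 0 1 = x 0 2%:R];
  omin_mul : S 3 [set x : 'rV[R]_3 | x 0 0 * x 0 1 = x 0 2%:R];
  omin_line : forall A, S 1%N A -> exists s : seq (interval R),
    [set t | A (const_mx t)] = \bigcup_(i in [set` s]) [set` i] }.

(* The library norm on 'rV[R]_n is the sup norm: it induces the usual topology
   of R^n, but metric notions must use the Euclidean norm below. *)
Definition dotp (R : realType) n (u v : 'rV[R]_n) : R :=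
  \sum_(i < n) u 0 i * v 0 i.

Definition enorm (R : realType) n (u : 'rV[R]_n) : R := Num.sqrt (dotp u u).

Definition dist_to (R : realType) n (X : set 'rV[R]_n) (a : 'rV[R]_n) : R :=
  inf [set enorm (a - x) | x in X].

Definition nearest_points (R : realType) n (X : set 'rV[R]_n) (a : 'rV[R]_n)
    : set 'rV[R]_n :=
  [set x | X x /\ enorm (a - x) = dist_to X a].

Definition medial_axis (R : realType) n (X : set 'rV[R]_n) : set 'rV[R]_n :=
  [set a | exists x y, [/\ nearest_points X a x, nearest_points X a y
                         & x <> y]].

(* C^k functions on an open set U. The derivative x |-> 'd f x is C^k iff all
   the directional derivatives 'D_v f are (V is finite-dimensional below). *)
Fixpoint Ck (R : realType) (V W : normedModType R) (k : nat)
    (U : set V) (f : V -> W) : Prop :=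
  match k with
  | 0 => forall x, U x -> {for x, continuous f}
  | k'.+1 => (forall x, U x -> differentiable f x) /\
             (forall v, Ck k' U ('D_v f))
  end.

(* M is locally straightened onto R^d x {0} by a C^k diffeomorphism f, with
   inverse g, between open subsets V and f @` V of R^n. *)
Definition submanifold (R : realType) n (k d : nat) (M : set 'rV[R]_n) : Prop :=
  (d <= n)%N /\
  forall x, M x -> exists (V : set 'rV[R]_n) (f g : 'rV[R]_n -> 'rV[R]_n),
    [/\ open V /\ V x,
        open (f @` V),
        Ck k V f /\ Ck k (f @` V) g,
        forall y, V y -> g (f y) = y
      & forall y, V y ->
          (M y <-> forall i : 'I_n, (d <= i)%N -> f y 0 i = 0)].

(* The dimension of a definable set: the largest dimension of a C^1 submanifold
   contained in it. *)
Definition has_dim (R : realType) n (X : set 'rV[R]_n) (d : nat) : Prop :=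
  (exists M, [/\ M `<=` X, M !=set0 & submanifold 1 d M]) /\
  (forall d' M, M `<=` X -> M !=set0 -> submanifold 1 d' M -> (d' <= d)%N).

Definition Reg (R : realType) n (k : nat) (X : set 'rV[R]_n) : set 'rV[R]_n :=
  [set x | X x /\
     exists U d, nbhs x U /\ submanifold k d (X `&` U)].

Definition Sng (R : realType) n (k : nat) (X : set 'rV[R]_n) : set 'rV[R]_n :=
  X `\` Reg k X.

(* Velocities at a of the C^1 curves in X through a; this is the tangent space
   T_a X (a linear subspace) when a is in Reg 1 X. *)
Definition tangent_space (R : realType) n (X : set 'rV[R]_n) (a : 'rV[R]_n)
    : set 'rV[R]_n :=
  [set v | exists (e : R) (c : R -> 'rV[R]_n),
     [/\ 0 < e,
         Ck 1 (ball 0 e) c,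
         forall t, ball 0 e t -> X (c t),
         c 0 = a
       & 'D_1 c 0 = v]].

(* The orthogonal projection onto the affine tangent space a + T_a X. *)
Definition tangent_proj (R : realType) n (X : set 'rV[R]_n) (a x : 'rV[R]_n)
    : 'rV[R]_n :=
  xget a [set q | tangent_space X a (q - a) /\
                  forall v, tangent_space X a v -> dotp (x - q) v = 0].

(* The function g computed in the closed ball U of radius r centred at a. The
   supremum is a maximum for small r and e, when a is in Reg 1 X, X is closed
   and a is not isolated in X. *)
Definition tangent_gap (R : realType) n (X : set 'rV[R]_n) (a : 'rV[R]_n)
    (r e : R) : R :=
  let p := tangent_proj X a in
  sup [set enorm (x - p x) | x in
         [set x | [/\ X x, enorm (x - a) <= r & enorm (p x - a) = e]]].

Definition superquadratic (R : realType) n (X : set 'rV[R]_n) (a : 'rV[R]_n)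
    : Prop :=
  \forall r \near 0^'+, tangent_gap X a r e / e ^+ 2 @[e --> 0^'+] --> +oo.

Definition SQ (R : realType) n (X : set 'rV[R]_n) : set 'rV[R]_n :=
  [set a | (Sng 2 X `&` Reg 1 X) a /\ superquadratic X a].

(* Main.v *)
Require Import Defs.
From HB Require Import structures.
From mathcomp Require Import all_boot all_order all_algebra.
From mathcomp Require Import all_classical all_reals all_analysis.
From mathcomp Require Import ring lra.

(* Near 0 the curve is a C^1 graph t |-> g t over one of its coordinates
   (x_j = t), and the coordinates of g are definable. A definable continuous
   function f is convex or concave on some (0, e): for each t the sign of
   f (t + h) + f (t - h) - 2 f t is constant for small h > 0, this sign is
   constant for small t > 0, and a continuous function which is locally
   midpoint convex is convex. Applied to f = g_i', the monotonicity of
   (f t - f 0) / t leaves two cases on each side of 0: either g_i' is Lipschitz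
   near 0, or (g_i' t - g_i' 0) / t tends to +oo or -oo. In the second case
   integration gives |g_i t - g_i' 0 t| / t^2 -> +oo, hence
   superquadracity. If the first case holds for all i and on both sides, then
   two distinct points g s, g t of X nearest to a point a close to 0 contradict
   the Taylor estimate of g at s. *)

Import Order.TTheory GRing.Theory Num.Theory.
Import numFieldNormedType.Exports.

Local Open Scope classical_set_scope.
Local Open Scope ring_scope.

Set Implicit Arguments.
Unset Strict Implicit.
Unset Printing Implicit Defensive.

(** * Definability of first-order formulas *)

(** O-minimality enters through one fact only: the truth value of a definable condition on a real
    [t] is constant on some [(0, d)]. For this test the graph of [g_i'] has to be definable. The
    charts of a submanifold carry no definability, so [g] is read off from [X] itself, and its
    derivative is expressed by an epsilon-delta formula in the graph of [g_i]. The two alternatives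
    are not symmetric. For superquadracity one coordinate on one side of 0 is enough, because the
    gap is a supremum. The Lipschitz bound is needed on both sides, because two nearest points may
    lie on opposite sides of 0, and for all coordinates, because the Taylor errors of all of them
    add up. *)

Section Definability.
Variables (R : realType) (S : forall n : nat, set (set 'rV[R]_n)).
Arguments S : clear implicits.
Variable S_omin : o_minimal_structure S.

Lemma definable_setI n (A B : set 'rV[R]_n) : S n A -> S n B -> S n (A `&` B).
Proof.
move=> SA SB; rewrite -(setCK (A `&` B)) setCI.
by apply: (omin_setC S_omin); apply: (omin_setU S_omin); apply: (omin_setC S_omin).
Qed.

Lemma definable_forall n k (A : 'I_k -> set 'rV[R]_n) :
  (forall l, S n (A l)) -> S n [set x | forall l, A l x].
Proof.
move=> SA.
have H (s : seq 'I_k) : S n [set x | forall l, l \in s -> A l x].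
  elim: s => [|l s IH].
    have -> : [set x | forall l, l \in [::] -> A l x] = setT by apply/seteqP; split.
    exact: (omin_setT S_omin).
  have -> : [set x | forall l', l' \in l :: s -> A l' x] =
            A l `&` [set x | forall l', l' \in s -> A l' x].
    apply/seteqP; split=> x /=.
      by move=> h; split=> [|l' ls]; apply: h; rewrite inE ?eqxx// ls orbT.
    by move=> [Al h] l'; rewrite inE => /orP[/eqP->//|]; exact: h.
  exact: definable_setI.
have -> : [set x | forall l, A l x] =
          [set x | forall l, l \in enum 'I_k -> A l x].
  by apply/seteqP; split=> x /= h l; [move=> _; exact: h|apply: h; rewrite mem_enum].
exact: H.
Qed.

(** Only products, diagonals and projections are given, so a reindexing along an arbitrary [s] is
    built by adjoining [k] new coordinates, equating them with the selected old ones and projecting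
    them away. *)
Lemma definable_preim k n (A : set 'rV[R]_k) (s : 'I_k -> 'I_n) :
  S k A -> S n [set x | A (\row_l x 0 (s l))].
Proof.
move=> SA.
pose D := [set z : 'rV[R]_(n + k) |
  forall l, z 0 (lshift k (s l)) = z 0 (rshift n l)].
have SD : S (n + k)%N D by apply: definable_forall => l; exact: (omin_diag S_omin).
have SP := omin_prod S_omin (omin_setT S_omin n) SA.
have := omin_proj S_omin (definable_setI SP SD).
congr (S n _); apply/seteqP; split=> x /=.
  move=> [z [[_ Az] Dz] <-]; congr (A _): Az; apply/rowP => l.
  by rewrite !mxE Dz.
move=> Ax; exists (row_mx x (\row_l x 0 (s l))).
  split; first by rewrite row_mxKr.
  by move=> l; rewrite row_mxEl row_mxEr mxE.
by rewrite row_mxKl.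
Qed.

Definition definable_fun n (F : 'rV[R]_n -> R) :=
  S (n + 1)%N [set z | F (lsubmx z) = rsubmx z 0 0].

Lemma definable_comp k n (A : set 'rV[R]_k) (F : 'I_k -> 'rV[R]_n -> R) :
  S k A -> (forall l, definable_fun (F l)) -> S n [set x | A (\row_l F l x)].
Proof.
move=> SA SF.
pose D := [set z : 'rV[R]_(n + k) |
  forall l, F l (lsubmx z) = z 0 (rshift n l)].
have SD : S (n + k)%N D.
  apply: definable_forall => l.
  pose s (i : 'I_(n + 1)) :=
    match fintype.split i with inl i => lshift k i | inr _ => rshift n l end.
  have := definable_preim s (SF l); congr (S _ _).
  apply/seteqP; split=> z /=.
    move=> h; rewrite [RHS](_ : _ = (rsubmx (\row_i z 0 (s i))) 0 0).
      by rewrite -h; congr F; apply/rowP => i; rewrite !mxE /s (unsplitK (inl i)).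
    by rewrite !mxE /s (unsplitK (inr _)).
  move=> h; rewrite [RHS](_ : _ = z 0 (rshift n l)).
    by rewrite -h; congr F; apply/rowP => i; rewrite !mxE /s (unsplitK (inl i)).
  by rewrite !mxE /s (unsplitK (inr _)).
have SP := omin_prod S_omin (omin_setT S_omin n) SA.
have := omin_proj S_omin (definable_setI SP SD).
congr (S n _); apply/seteqP; split=> x /=.
  move=> [z [[_ Az] Dz] <-]; congr (A _): Az; apply/rowP => l.
  by rewrite !mxE Dz.
move=> Ax; exists (row_mx x (\row_l F l x)).
  split; first by rewrite row_mxKr.
  by move=> l; rewrite row_mxKl row_mxEr mxE.
by rewrite row_mxKl.
Qed.

Lemma definable_fun_coord n (i : 'I_n) : definable_fun (fun x => x 0 i).
Proof.
have := omin_diag S_omin (lshift 1 i) (rshift n (0 : 'I_1)).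
by congr (S _ _); apply/seteqP; split=> z /=; rewrite !mxE.
Qed.

Lemma definable_fun_cst n (c : R) : definable_fun (fun _ : 'rV[R]_n => c).
Proof.
have := definable_preim (fun=> rshift n (0 : 'I_1)) (omin_point S_omin c).
congr (S _ _); apply/seteqP; split=> z /=.
  by move=> /rowP /(_ 0); rewrite !mxE.
by move=> h; apply/rowP => i; rewrite !mxE h mxE.
Qed.

Lemma definable_fun_lsubmx n (F : 'rV[R]_n -> R) :
  definable_fun F -> definable_fun (fun z : 'rV[R]_(n + 1) => F (lsubmx z)).
Proof.
move=> SF.
pose s (i : 'I_(n + 1)) : 'I_(n + 1 + 1) :=
  match fintype.split i with
  | inl i => lshift 1 (lshift 1 i)
  | inr j => rshift (n + 1) j
  end.
have := definable_preim s SF; congr (S _ _).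
have E (z : 'rV[R]_(n + 1 + 1)) : lsubmx (\row_i z 0 (s i)) = lsubmx (lsubmx z).
  by apply/rowP => i; rewrite !mxE /s (unsplitK (inl i)).
have E' (z : 'rV[R]_(n + 1 + 1)) : rsubmx (\row_i z 0 (s i)) = rsubmx z.
  by apply/rowP => i; rewrite !mxE /s (unsplitK (inr i)).
by apply/seteqP; split=> z /=; rewrite E E'.
Qed.

Lemma definable_comp2 n (r : R -> R -> Prop) (F G : 'rV[R]_n -> R) :
  S 2 [set x | r (x 0 0) (x 0 1)] -> definable_fun F -> definable_fun G ->
  S n [set x | r (F x) (G x)].
Proof.
move=> Sr SF SG.
have := @definable_comp 2 n _ (fun l => if l == 0 then F else G) Sr.
rewrite (_ : mkset _ = [set x | r (F x) (G x)]); first by apply => l; case: ifP.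
by apply/seteqP; split=> x /=; rewrite !mxE.
Qed.

Lemma definable_comp3 n (A : set 'rV[R]_3) (F G H : 'rV[R]_n -> R) :
  S 3 A -> definable_fun F -> definable_fun G -> definable_fun H ->
  S n [set x | A (\row_(l < 3) if l == 0 then F x else if l == 1 then G x else H x)].
Proof.
move=> SA SF SG SH.
have := @definable_comp 3 n _
  (fun l => if l == 0 then F else if l == 1 then G else H) SA.
rewrite (_ : mkset _ = [set x | A (\row_(l < 3)
    if l == 0 then F x else if l == 1 then G x else H x)]).
  by apply => l; case: ifP => // _; case: ifP.
apply/seteqP; split=> x /=; congr (A _); apply/rowP => l; rewrite !mxE;
  by case: ifP => // _; case: ifP.
Qed.

Lemma definable_fun_last n : definable_fun (fun z : 'rV[R]_(n + 1) => rsubmx z 0 0).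
Proof.
have -> : (fun z : 'rV[R]_(n + 1) => rsubmx z 0 0) = (fun z => z 0 (rshift n 0)).
  by apply/funext => z; rewrite mxE.
exact: definable_fun_coord.
Qed.

Lemma definable_fun_add n (F G : 'rV[R]_n -> R) :
  definable_fun F -> definable_fun G -> definable_fun (fun x => F x + G x).
Proof.
move=> SF SG.
have := definable_comp3 (omin_add S_omin) (definable_fun_lsubmx SF)
  (definable_fun_lsubmx SG) (@definable_fun_last n).
by congr (S _ _); apply/seteqP; split=> z /=; rewrite !mxE.
Qed.

Lemma definable_fun_mul n (F G : 'rV[R]_n -> R) :
  definable_fun F -> definable_fun G -> definable_fun (fun x => F x * G x).
Proof.
move=> SF SG.
have := definable_comp3 (omin_mul S_omin) (definable_fun_lsubmx SF)
  (definable_fun_lsubmx SG) (@definable_fun_last n).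
by congr (S _ _); apply/seteqP; split=> z /=; rewrite !mxE.
Qed.

(** The order comes from squares: [F x <= G x] means that [F x + y * y = G x] for some [y]. *)
Lemma definable_le n (F G : 'rV[R]_n -> R) :
  definable_fun F -> definable_fun G -> S n [set x | F x <= G x].
Proof.
move=> SF SG.
have L := @definable_fun_last n.
have SE : S (n + 1)%N [set z : 'rV[R]_(n + 1) |
    F (lsubmx z) + rsubmx z 0 0 * rsubmx z 0 0 = G (lsubmx z)].
  have := definable_comp3 (omin_add S_omin) (definable_fun_lsubmx SF)
    (definable_fun_mul L L) (definable_fun_lsubmx SG).
  by congr (S _ _); apply/seteqP; split=> z /=; rewrite !mxE.
have := omin_proj S_omin SE; congr (S _ _); apply/seteqP; split=> x /=.
  by move=> [z /= Ez <-]; rewrite -Ez lerDl -expr2 sqr_ge0.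
move=> FG; exists (row_mx x (const_mx (Num.sqrt (G x - F x)))); last first.
  by rewrite row_mxKl.
rewrite /= row_mxKl row_mxKr mxE -expr2 sqr_sqrtr ?subr_ge0//; ring.
Qed.

End Definability.

(** * First-order formulas and germs at 0 of definable conditions *)

Inductive term (R : Type) :=
  Var of nat | Cst of R | Add of term R & term R | Mul of term R & term R.

(** With formulas as data, definability of nested quantifiers is proved once. A concrete condition
    is then handled by exhibiting a formula whose meaning reduces to it by computation. *)
Inductive formula (R : Type) :=
| Le of term R & term R
| Lt of term R & term R
| Rel of term R & term R
| Not of formula R
| And of formula R & formula R
| Imp of formula R & formula R
| Ex of formula R
| All of formula R.

Arguments Var {R} _.

Definition scons (R : Type) (y : R) (e : nat -> R) (i : nat) : R :=
  if i is j.+1 then e j else y.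

Fixpoint teval (R : realType) (e : nat -> R) (t : term R) : R :=
  match t with
  | Var i => e i
  | Cst c => c
  | Add t u => teval e t + teval e u
  | Mul t u => teval e t * teval e u
  end.

(* Variables are de Bruijn indices; [r] interprets the binary symbol [Rel]. *)
Fixpoint feval (R : realType) (r : R -> R -> Prop) (e : nat -> R)
    (F : formula R) : Prop :=
  match F with
  | Le t u => teval e t <= teval e u
  | Lt t u => teval e t < teval e u
  | Rel t u => r (teval e t) (teval e u)
  | Not F => ~ feval r e F
  | And F G => feval r e F /\ feval r e G
  | Imp F G => feval r e F -> feval r e G
  | Ex F => exists y, feval r (scons y e) F
  | All F => forall y, feval r (scons y e) F
  end.

Definition env (R : realType) n (x : 'rV[R]_n) (i : nat) : R :=
  if insub i is Some j then x 0 j else 0.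

Section Formulas.
Variables (R : realType) (S : forall n : nat, set (set 'rV[R]_n)).
Arguments S : clear implicits.
Variable S_omin : o_minimal_structure S.
Variable r : R -> R -> Prop.
Hypothesis Sr : S 2 [set x | r (x 0 0) (x 0 1)].

Lemma definable_term n (t : term R) :
  definable_fun S (fun x : 'rV[R]_n => teval (env x) t).
Proof.
elim: t => [i|c|t IHt u IHu|t IHt u IHu] /=.
- rewrite /env; case: insubP => [j _ _|_]; first exact: definable_fun_coord.
  exact: definable_fun_cst.
- exact: definable_fun_cst.
- exact: definable_fun_add.
- exact: definable_fun_mul.
Qed.

Lemma env_row_mx n (y : 'rV[R]_1) (x : 'rV[R]_n) :
  env (row_mx y x) = scons (y 0 0) (env x).
Proof.
apply/funext => -[|i] /=; rewrite /env.
  case: insubP => [j _ j0|//]; rewrite (_ : j = lshift n 0) ?row_mxEl//.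
  exact: val_inj.
case: insubP => [j _ ji|].
  case: insubP => [k _ ki|]; last by rewrite -ltnS -ji ltn_ord.
  by rewrite (_ : j = rshift 1 k) ?row_mxEr//; apply: val_inj; rewrite /= ji ki.
case: insubP => [k _ ki|//]; by rewrite add1n ltnS -ki ltn_ord.
Qed.

Lemma definable_exists n (P : (nat -> R) -> Prop) :
  S (1 + n)%N [set x | P (env x)] ->
  S n [set x : 'rV[R]_n | exists y, P (scons y (env x))].
Proof.
move=> SP.
(* [scons] puts the bound variable in front, whereas [omin_proj] forgets the last coordinates; [s]
   reconciles the two orders. *)
pose s (i : 'I_(1 + n)) : 'I_(n + 1) :=
  match fintype.split i with inl j => rshift n j | inr i => lshift 1 i end.
have E (z : 'rV[R]_(n + 1)) : \row_i z 0 (s i) = row_mx (rsubmx z) (lsubmx z).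
  apply/rowP => i; rewrite !mxE /s; case: splitP => j _; by rewrite mxE.
have := omin_proj S_omin (definable_preim S_omin s SP).
congr (S n _); apply/seteqP; split=> x /=.
  by move=> [z /=]; rewrite E env_row_mx => Pz <-; exists (rsubmx z 0 0).
move=> [y Py]; exists (row_mx x (const_mx y)); last by rewrite row_mxKl.
by rewrite /= E env_row_mx row_mxKl row_mxKr mxE.
Qed.

Lemma definable_formula n (F : formula R) :
  S n [set x : 'rV[R]_n | feval r (env x) F].
Proof.
elim: F n => [t u|t u|t u|F IH|F IHF G IHG|F IHF G IHG|F IH|F IH] n /=.
- exact: (definable_le S_omin (definable_term n t) (definable_term n u)).
- have := omin_setC S_omin
    (definable_le S_omin (definable_term n u) (definable_term n t)).
  by congr (S _ _); apply/seteqP; split=> x /=; rewrite ltNge => /negP.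
- exact: (definable_comp2 S_omin Sr (definable_term n t) (definable_term n u)).
- exact: (omin_setC S_omin (IH n)).
- exact: (definable_setI S_omin (IHF n) (IHG n)).
- have := omin_setU S_omin (omin_setC S_omin (IHF n)) (IHG n).
  congr (S _ _); apply/seteqP; split=> x /=; first by case.
  by case: (pselect (feval r (env x) F)) => h g; [right; exact: g|left].
- exact: (definable_exists (P := fun e => feval r e F) (IH _)).
- have := omin_setC S_omin (definable_exists (P := fun e => ~ feval r e F)
    (omin_setC S_omin (IH (1 + n)%N))).
  congr (S _ _); apply/seteqP; split=> x /=.
    by move=> h y; apply: contrapT => g; apply: h; exists y.
  by move=> h [y]; apply; exact: h.
Qed.

Lemma definable_rel2 (F : formula R) (q : R -> R -> Prop) :
  (forall a b, q a b <-> feval r (scons a (scons b (fun=> 0))) F) ->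
  S 2 [set x | q (x 0 0) (x 0 1)].
Proof.
move=> qF; have := definable_formula 2 F; congr (S _ _).
have E (x : 'rV[R]_2) : env x = scons (x 0 0) (scons (x 0 1) (fun=> 0)).
  apply/funext => i; rewrite /env; case: insubP => [j _ <-|].
    by case: j => -[|[|//]] h /=; congr (x 0 _); exact: val_inj.
  by case: i => [|[|]].
by apply/seteqP; split=> x /=; rewrite E qF.
Qed.

(** A positive endpoint is avoided by taking [d] below it, and an endpoint that is at most 0 lies on
    the same side of every [t > 0]. *)
Lemma interval_right0 (i : interval R) : exists2 d, 0 < d &
  (forall t, 0 < t < d -> t \in i) \/ (forall t, 0 < t < d -> t \notin i).
Proof.
have L (b : itv_bound R) : exists2 d, 0 < d &
    (forall t, 0 < t < d -> (b <= BLeft t)%O) \/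
    (forall t, 0 < t < d -> ~~ (b <= BLeft t)%O).
  case: b => [[] a|[]]; rewrite ?bnd_simp.
  - have [a0|a0] := leP a 0; [exists 1 => //; left|exists a => //; right];
      by move=> t /andP[t0 td]; rewrite bnd_simp; lra.
  - have [a0|a0] := leP a 0; [exists 1 => //; left|exists a => //; right];
      by move=> t /andP[t0 td]; rewrite bnd_simp; lra.
  - by exists 1 => //; left.
  - by exists 1 => //; right.
have U (b : itv_bound R) : exists2 d, 0 < d &
    (forall t, 0 < t < d -> (BRight t <= b)%O) \/
    (forall t, 0 < t < d -> ~~ (BRight t <= b)%O).
  case: b => [[] a|[]].
  - have [a0|a0] := leP a 0; [exists 1 => //; right|exists a => //; left];
      by move=> t /andP[t0 td]; rewrite bnd_simp; lra.
  - have [a0|a0] := leP a 0; [exists 1 => //; right|exists a => //; left];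
      by move=> t /andP[t0 td]; rewrite bnd_simp; lra.
  - by exists 1 => //; right.
  - by exists 1 => //; left.
case: i => a b; have [d d0 da] := L a; have [d' d'0 db] := U b.
exists (Num.min d d'); first by rewrite lt_min d0.
have H t : 0 < t < Num.min d d' -> 0 < t < d /\ 0 < t < d'.
  by rewrite lt_min => /and3P[-> -> ->].
case: da => da; last by right=> t /H[/da h] _; apply/negP; rewrite itv_boundlr (negbTE h).
case: db => db; last first.
  by right=> t /H[_ /db h]; apply/negP; rewrite itv_boundlr (negbTE h) andbF.
by left=> t /H[/da + /db]; rewrite itv_boundlr => -> ->.
Qed.

(** By [omin_line] the condition defines a finite union of intervals, and each of them is decided on
    some [(0, d)]. Real parameters may enter [F] through [Cst]. *)
Lemma definable_germ (F : formula R) (P : R -> Prop) :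
  (forall t, P t <-> feval r (scons t (fun=> 0)) F) ->
  exists2 d, 0 < d &
    (forall t, 0 < t < d -> P t) \/ (forall t, 0 < t < d -> ~ P t).
Proof.
move=> PF.
have [s sE] := omin_line S_omin (definable_formula 1 F).
have E (t : R) : env (const_mx t : 'rV_1) = scons t (fun=> 0).
  apply/funext => i; rewrite /env; case: insubP => [j _ <-|].
    by rewrite mxE; case: j => -[].
  by case: i.
have {}PF t : P t <-> exists2 i, i \in s & t \in i.
  have /seteqP[h1 h2] := sE.
  rewrite PF -E; split=> [/h1[i /= si it]|[i si it]]; first by exists i.
  by apply: h2; exists i.
suff [d d0 H] : exists2 d, 0 < d &
    (forall t, 0 < t < d -> exists2 i, i \in s & t \in i) \/
    (forall t, 0 < t < d -> ~ exists2 i, i \in s & t \in i).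
  by exists d => //; case: H => H; [left|right] => t /H; rewrite PF.
elim: s {sE PF} => [|i s [d d0 IH]]; first by exists 1 => //; right=> t _ [].
have [d' d'0 H] := interval_right0 i.
exists (Num.min d d'); first by rewrite lt_min d0.
have T t : 0 < t < Num.min d d' -> 0 < t < d /\ 0 < t < d'.
  by rewrite lt_min => /and3P[-> -> ->].
case: IH => IH.
  by left=> t /T[/IH[j js jt] _]; exists j => //; rewrite inE js orbT.
case: H => H; first by left=> t /T[_ /H it]; exists i => //; rewrite inE eqxx.
right=> t /T[/IH nIH /H nit] [j]; rewrite inE => /orP[/eqP->|js jt].
  by move=> it; rewrite it in nit.
by apply: nIH; exists j.
Qed.

End Formulas.

(** For a small box this planar set is, near 0, the graph of coordinate [i] of [X] as a function of
    coordinate [j]. A box is used because it is cut out by coordinate inequalities. *)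
Lemma definable_coord_image (R : realType) S n (X : set 'rV[R]_n)
    (p : R) (j i : 'I_n) :
  o_minimal_structure S -> @S n X ->
  @S 2 [set z | exists x, [/\ X x, forall l, `|x 0 l| < p, x 0 j = z 0 0
                            & x 0 i = z 0 1]].
Proof.
move=> S_omin SX.
have SB : @S n [set x : 'rV[R]_n | forall l, `|x 0 l| < p].
  apply: (@definable_forall R S S_omin n n
    (fun l => [set x : 'rV[R]_n | `|x 0 l| < p])) => l.
  have cx := @definable_fun_coord R S S_omin n l.
  have cc q := @definable_fun_cst R S S_omin n q.
  have := definable_setI S_omin (omin_setC S_omin (definable_le S_omin (cc p) cx))
    (omin_setC S_omin (definable_le S_omin cx (cc (- p)))).
  congr (@S _ _); apply/seteqP; split=> x /=.
    by move=> [/negP + /negP]; rewrite -!ltNge ltr_norml => -> ->.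
  by rewrite ltr_norml => /andP[h1 h2]; split; apply/negP; rewrite -ltNge.
have SP := omin_prod S_omin (omin_setT S_omin 2) (definable_setI S_omin SX SB).
have D1 := omin_diag S_omin (lshift n (0 : 'I_2)) (rshift 2 j).
have D2 := omin_diag S_omin (lshift n (1 : 'I_2)) (rshift 2 i).
have := omin_proj S_omin (definable_setI S_omin SP (definable_setI S_omin D1 D2)).
congr (@S _ _); apply/seteqP; split=> z /=.
  move=> [w [[_ [Xw Bw]] [wj wi]] <-]; exists (rsubmx w).
  by split=> //; rewrite !mxE ?wj ?wi.
move=> [x [Xx Bx xj xi]]; exists (row_mx z x); last by rewrite row_mxKl.
by rewrite row_mxKr; do 2?split=> //=; rewrite row_mxEl row_mxEr.
Qed.

(** Germs are taken at the right of 0; the left side is reached through the reflected function. *)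
Lemma definable_reflect (R : realType) S (r : R -> R -> Prop) :
  o_minimal_structure S -> @S 2 [set x | r (x 0 0) (x 0 1)] ->
  @S 2 [set x | r (- x 0 0) (x 0 1)].
Proof.
move=> S_omin Sr.
have := definable_comp2 S_omin Sr
  (definable_fun_mul S_omin (definable_fun_cst S_omin 2 (-1))
    (definable_fun_coord S_omin 0))
  (definable_fun_coord S_omin (1 : 'I_2)).
by congr (@S _ _); apply/seteqP; split=> x /=; rewrite mulN1r.
Qed.

(** * Definable functions of class C^1 near 0 *)

Lemma continuous_itvcc (R : realType) (f : R -> R) (a b : R) :
  (forall t, a <= t <= b -> {for t, continuous f}) ->
  {within `[a, b], continuous f}.
Proof.
move=> cf; apply: continuous_in_subspaceT => t.
by rewrite inE /= in_itv; exact: cf.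
Qed.

(* At an interior maximum of f minus its chord plus a small multiple of
   (t - a)(t - b), the second symmetric difference would be positive. *)
Lemma local_midpoint_convex (R : realType) (f : R -> R) (a b : R) :
  (forall t, a <= t <= b -> {for t, continuous f}) ->
  (forall t, a < t < b -> exists2 e, 0 < e &
    forall h, 0 < h < e -> 2 * f t <= f (t + h) + f (t - h)) ->
  forall x, a < x < b -> f x * (b - a) <= f a * (b - x) + f b * (x - a).
Proof.
move=> cf H x /andP[ax xb]; rewrite leNgt; apply/negP => lt.
pose D := f x * (b - a) - (f a * (b - x) + f b * (x - a)).
have D0 : 0 < D by rewrite /D subr_gt0.
have ab : 0 < b - a by lra.
(* With this [e] the quadratic term lowers the value at [x] by at most [e * (b - a) ^+ 2 = D / 2],
   so half of the excess [D] survives. Multiplying by [b - a] keeps the chord free of division. *)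
pose e := D / (2 * (b - a) ^+ 2).
have e0 : 0 < e by rewrite divr_gt0 ?mulr_gt0 ?exprn_gt0.
pose k t := f t * (b - a) - (f a * (b - t) + f b * (t - a)) + e * ((t - a) * (t - b)).
have kx : 0 < k x.
  have : e * (b - a) ^+ 2 = D / 2 by rewrite /e; field; lra.
  have : (x - a) * (b - x) <= (b - a) ^+ 2.
    by rewrite expr2; apply: ler_pM; lra.
  move=> /(ler_wpM2l (ltW e0)) le1 eq1; rewrite /k -/D.
  have -> : e * ((x - a) * (x - b)) = - (e * ((x - a) * (b - x))) by ring.
  lra.
have ck : {within `[a, b], continuous k}.
  apply: continuous_itvcc => t tab; apply: cvgD; first apply: cvgB.
  - by apply: cvgM; [exact: cf|exact: cvg_cst].
  - by apply: cvgD; apply: cvgM; (try exact: cvg_cst); apply: cvgB;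
      (try exact: cvg_cst); exact: cvg_id.
  - by apply: cvgM; [exact: cvg_cst|]; apply: cvgM; apply: cvgB;
      (try exact: cvg_cst); exact: cvg_id.
have [m mab mmax] := EVT_max (ltW (lt_trans ax xb)) ck.
have km : 0 < k m.
  by apply: lt_le_trans kx _; apply: mmax; rewrite in_itv /= !ltW.
have ka : k a = 0 by rewrite /k; ring.
have kb : k b = 0 by rewrite /k; ring.
move: mab; rewrite in_itv /= !le_eqVlt => /andP[/orP[/eqP am|am]].
  by rewrite -am ka ltxx in km.
move=> /orP[/eqP mb|mb]; first by rewrite mb kb ltxx in km.
have [|n n0 Hn] := H m; first by rewrite am.
pose h := Num.min (n / 2) (Num.min (m - a) (b - m)).
have h0 : 0 < h by rewrite !lt_min; apply/and3P; split; lra.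
have : h <= n / 2 /\ h <= m - a /\ h <= b - m.
  by rewrite /h !ge_min !lexx !orbT.
move=> [hn [ha hb]].
have {}Hn := Hn h; have {}Hn := Hn _.
have : 2 * f m <= f (m + h) + f (m - h) by apply: Hn; lra.
rewrite -subr_ge0 => /mulr_ge0 /(_ (ltW ab)) le1.
have k1 : k (m + h) <= k m by apply: mmax; rewrite in_itv /=; lra.
have k2 : k (m - h) <= k m by apply: mmax; rewrite in_itv /=; lra.
have eh : 0 < e * h ^+ 2 by rewrite mulr_gt0 ?exprn_gt0.
have : k (m + h) + k (m - h) - 2 * k m =
  (f (m + h) + f (m - h) - 2 * f m) * (b - a) + 2 * (e * h ^+ 2).
  by rewrite /k; ring.
lra.
Qed.

Definition convex_upto (R : realType) (d : R) (f : R -> R) :=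
  forall x y z, 0 <= x -> x < y -> y < z -> z <= d ->
    f y * (z - x) <= f x * (z - y) + f z * (y - x).

(** The condition on second differences is only available at [t > 0]; continuity at 0 carries
    convexity to the closed interval. *)
Lemma local_midpoint_convex_upto (R : realType) (f : R -> R) (d e : R) :
  0 < d -> 0 < e -> (forall t, `|t| < d -> {for t, continuous f}) ->
  (forall t, 0 < t < e -> t < d -> exists2 e', 0 < e' &
    forall h, 0 < h < e' -> 2 * f t <= f (t + h) + f (t - h)) ->
  exists2 e', 0 < e' < d & convex_upto e' f.
Proof.
move=> d0 e0 cf H; exists (Num.min d e / 2).
  have : 0 < Num.min d e by rewrite lt_min d0.
  have : Num.min d e <= d by rewrite ge_min lexx.
  by move=> *; apply/andP; split; lra.
have me : Num.min d e <= e by rewrite ge_min lexx orbT.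
have md : Num.min d e <= d by rewrite ge_min lexx.
have m0 : 0 < Num.min d e by rewrite lt_min d0.
move=> x y z x0 xy yz zd; apply: local_midpoint_convex; last by rewrite xy.
  by move=> t /andP[xt tz]; apply: cf; rewrite ger0_norm; lra.
by move=> t /andP[xt tz]; apply: H; lra.
Qed.

(** Germs are used twice: in [t], to decide whether local midpoint convexity [P t] holds for all
    small [t] or for none, and in [h] at a fixed [t], to turn its failure into local midpoint
    concavity. *)
Lemma definable_convex_or_concave (R : realType) S (r : R -> R -> Prop)
    (f : R -> R) d :
  o_minimal_structure S -> @S 2 [set x | r (x 0 0) (x 0 1)] -> 0 < d ->
  (forall t y, `|t| < d -> (r t y <-> y = f t)) ->
  (forall t, `|t| < d -> {for t, continuous f}) ->
  exists2 e, 0 < e < d & convex_upto e f \/ convex_upto e (fun t => - f t).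
Proof.
move=> S_omin Sr d0 rf cf.
pose Q t h := forall a b c, r t a -> r (t + h) b -> r (t + -1 * h) c ->
  2 * a <= b + c.
pose P t := exists e, 0 < e /\ forall h, 0 < h /\ h < e -> Q t h.
(* The three [All] bind [a], [b], [c] as variables 2, 1, 0, so an outer variable [i] has to be
   passed to [FQ] as [i + 3]. *)
pose FQ (t h : term R) := All (All (All (Imp (Rel t (Var 2))
  (Imp (Rel (Add t h) (Var 1))
  (Imp (Rel (Add t (Mul (Cst (-1)) h)) (Var 0))
    (Le (Mul (Cst 2) (Var 2)) (Add (Var 1) (Var 0)))))))).
have QE t h : `|t| < d -> 0 < h < d - `|t| ->
    (Q t h <-> 2 * f t <= f (t + h) + f (t - h)).
  move=> td /andP[h0 hd].
  have thd : `|t + h| < d.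
    by have := ler_normD t h; rewrite (gtr0_norm h0); lra.
  have thd' : `|t - h| < d.
    by have := ler_normB t h; rewrite (gtr0_norm h0); lra.
  split=> [|le a b c]; first by apply; rewrite ?mulN1r; apply/rf.
  by rewrite mulN1r => /(rf _ _ td) -> /(rf _ _ thd) -> /(rf _ _ thd') ->.
have Qgerm t : exists2 e, 0 < e &
    (forall h, 0 < h < e -> Q t h) \/ (forall h, 0 < h < e -> ~ Q t h).
  apply: (@definable_germ R S S_omin r Sr (FQ (Cst t) (Var 3))).
  by move=> h; split.
have [e e0 HP] : exists2 e, 0 < e &
    (forall t, 0 < t < e -> P t) \/ (forall t, 0 < t < e -> ~ P t).
  apply: (@definable_germ R S S_omin r Sr
    (Ex (And (Lt (Cst 0) (Var 0))
      (All (Imp (And (Lt (Cst 0) (Var 0)) (Lt (Var 0) (Var 1)))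
        (FQ (Var 5) (Var 3))))))).
  by move=> t; split.
have min0 t e' : 0 < t -> t < d -> 0 < e' -> 0 < Num.min e' (d - `|t|).
  by move=> t0 td e'0; rewrite lt_min e'0 gtr0_norm ?subr_gt0.
have lemin h e' t : 0 < h < Num.min e' (d - `|t|) ->
    0 < h /\ h < e' /\ 0 < h < d - `|t|.
  by rewrite lt_min => /and3P[-> -> ->].
case: HP => HP.
  have [|e' ? ?] := local_midpoint_convex_upto d0 e0 cf; last by exists e' => //; left.
  move=> t te td; have /andP[t0 _] := te.
  have [e' [e'0 H]] := HP t te.
  exists (Num.min e' (d - `|t|)); first exact: min0.
  move=> h /lemin[h0 [he hd]]; apply/QE => //; first by rewrite gtr0_norm.
  exact: H.
have cf' t : `|t| < d -> {for t, continuous (fun t => - f t)}.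
  by move=> td; apply: cvgN; exact: cf.
have [|e' ? ?] := local_midpoint_convex_upto d0 e0 cf'; last by exists e' => //; right.
move=> t te td; have /andP[t0 _] := te.
(* Failure of [P t] only says that [Q t h] fails for arbitrarily small [h]; the germ in [h] upgrades
   this to all small [h]. *)
have [e' e'0 [H|H]] := Qgerm t.
  by exfalso; apply: (HP t te); exists e'; split => // h [h0 h1]; apply: H; rewrite h0.
exists (Num.min e' (d - `|t|)); first exact: min0.
move=> h /lemin[h0 [he hd]].
have := H h; rewrite h0 he => /(_ isT).
rewrite QE// ?gtr0_norm// => /negP; rewrite -ltNge; lra.
Qed.

Lemma is_derive1_eps (R : realType) (f : R -> R) (t l e : R) :
  is_derive t 1 f l -> 0 < e ->
  exists2 n, 0 < n & forall h, `|h| < n -> `|f (t + h) - f t - l * h| <= e * `|h|.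
Proof.
move=> /is_derive1_caratheodory [g [fg cg gt]] e0.
have /cvgrPdist_le /(_ _ e0) /nbhs_ballP[n /= n0 H] := cg.
exists n => // h hn; have := H (t + h).
rewrite /ball /= opprD addrA subrr sub0r normrN => /(_ hn) le.
rewrite fg [t + h]addrC addrK -gt -mulrBl normrM distrC [h + t]addrC.
exact: ler_wpM2r.
Qed.

Section DerivativeRelation.
Variables (R : realType) (r : R -> R -> Prop).

(* Products by -1 and squares replace differences and absolute values, so that
   this is literally the interpretation of a formula. *)
Definition derive_rel (t y : R) :=
  forall e, 0 < e -> exists n, 0 < n /\ forall h, h * h < n ->
    forall a b, r t a -> r (t + h) b ->
    (b + -1 * a + -1 * (y * h)) * (b + -1 * a + -1 * (y * h)) <= e * (h * h).

Lemma definable_derive_rel S :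
  o_minimal_structure S -> @S 2 [set x | r (x 0 0) (x 0 1)] ->
  @S 2 [set x | derive_rel (x 0 0) (x 0 1)].
Proof.
move=> S_omin Sr.
(* Under all five binders, [b], [a], [h], [n], [e], [t], [y] are the variables 0 to 6. *)
pose D := Add (Add (Var 0) (Mul (Cst (-1)) (Var 1)))
  (Mul (Cst (-1)) (Mul (Var 6) (Var 2))) : term R.
apply: (@definable_rel2 R S S_omin r Sr
 (All (Imp (Lt (Cst 0) (Var 0)) (Ex (And (Lt (Cst 0) (Var 0))
   (All (Imp (Lt (Mul (Var 0) (Var 0)) (Var 1))
     (All (All (Imp (Rel (Var 5) (Var 1)) (Imp (Rel (Add (Var 5) (Var 2)) (Var 0))
       (Le (Mul D D) (Mul (Var 4) (Mul (Var 2) (Var 2))))))))))))))).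
by move=> a b; split.
Qed.

Lemma derive_relE (f : R -> R) (d t y l : R) :
  (forall t y, `|t| < d -> (r t y <-> y = f t)) ->
  `|t| < d -> is_derive t 1 f l -> derive_rel t y <-> y = l.
Proof.
move=> rf td fl.
have sq (h : R) : `|h| ^+ 2 = h * h by rewrite real_normK ?num_real.

have key (e : R) : 0 < e -> exists2 n : R, 0 < n & forall h : R, h * h < n ->
    `|t + h| < d /\
    (f (t + h) - f t - l * h) * (f (t + h) - f t - l * h) <= e * (h * h).
  move=> e0; have [|n n0 H] := is_derive1_eps fl (e := Num.sqrt e).
    by rewrite sqrtr_gt0.
  pose m := Num.min n (d - `|t|).
  have m0 : 0 < m by rewrite lt_min n0 subr_gt0.
  exists (m ^+ 2); first by rewrite exprn_gt0.
  move=> h; rewrite -(sq h) ltr_pXn2r ?nnegrE ?(ltW m0)// lt_min => /andP[hn hd].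
  split; first by have := ler_normD t h; lra.
  rewrite -(sq (f (t + h) - f t - l * h)) -[e in leRHS](sqr_sqrtr (ltW e0)).
  rewrite -exprMn ler_pXn2r ?nnegrE//; first exact: H.
split=> [yD|-> e /key[n n0 H]]; last first.
  exists n; split=> // h hn a b; have [thd le] := H h hn.
  by move=> /(rf _ _ td) -> /(rf _ _ thd) ->; rewrite !mulN1r.
apply/eqP; rewrite -subr_eq0 -sqrf_eq0 eq_le sqr_ge0 andbT.
apply/ler_addgt0Pl => e e0; rewrite addr0.
(* Both first-order estimates are compared at one increment [h]: [(y - l)^2 h^2] is at most twice
   the sum of the two squared errors, hence at most [4 * (e / 4) * h^2]. *)
have e4 : 0 < e / 4 by lra.
have [n n0 H] := key _ e4.
have [n' [n'0 H']] := yD _ e4.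
pose m := Num.min n n' / 2.
have [m0 mn mn'] : [/\ 0 < m, m < n & m < n'].
  have h0 : 0 < Num.min n n' by rewrite lt_min n0.
  have h1 : Num.min n n' <= n by rewrite ge_min lexx.
  have h2 : Num.min n n' <= n' by rewrite ge_min lexx orbT.
  by split; rewrite /m; lra.
pose h := Num.sqrt m.
have hh : h * h = m by rewrite -expr2 sqr_sqrtr // ltW.
have [thd le1] : `|t + h| < d /\ _ := H h ltac:(by rewrite hh).
have := H' h; rewrite hh => /(_ mn' (f t) (f (t + h))).
move=> /(_ (proj2 (rf _ _ td) erefl) (proj2 (rf _ _ thd) erefl)).
rewrite !mulN1r => le2; rewrite hh in le1.
rewrite -(ler_pM2r m0) -hh.
set A := f (t + h) - f t in le1 le2.
have := sqr_ge0 ((A - y * h) + (A - l * h)).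
rewrite -hh in le1 le2; move: le1 le2; rewrite !expr2; nra.
Qed.
End DerivativeRelation.

(** Slopes of a convex function increase. On [[0, d / 2)] they are bounded above by the slope [K]
    over [[d / 2, d]], so only a lower bound at 0 can fail; if it does, the slope from 0 drops below
    [- M] at some point and stays there at all smaller ones. *)
Lemma convex_upto_lipschitz_or_steep (R : realType) (f : R -> R) (d : R) :
  0 < d -> convex_upto d f ->
  (exists L n, [/\ 0 < n, n <= d & forall s t, 0 <= s -> s < t -> t < n ->
     `|f t - f s| <= L * (t - s)]) \/
  (forall M, exists n, [/\ 0 < n, n <= d & forall t, 0 < t < n ->
     f t - f 0 <= - M * t]).
Proof.
move=> d0 cf.
have [[m Hm]|nm] := pselect (exists m, forall t, 0 < t < d -> m * t <= f t - f 0).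
  left; pose K := (f d - f (d / 2)) / (d / 2).
  exists (`|K| + `|m|), (d / 2); split; [lra|lra|].
  move=> s t s0 st td; have ts : 0 < t - s by lra.
  have up : f t - f s <= K * (t - s).
    have c1 : (f t - f s) * (d / 2 - t) <= (f (d / 2) - f t) * (t - s).
      have := @cf s t (d / 2) s0 st td; lra.
    have c2 : (f (d / 2) - f t) * (d / 2) <= (f d - f (d / 2)) * (d / 2 - t).
      have := @cf t (d / 2) d; lra.
    have dt : 0 < d / 2 - t by lra.
    have d2 : 0 < d / 2 by lra.
    rewrite -(ler_pM2r dt) -(ler_pM2r d2) (le_trans (ler_wpM2r (ltW d2) c1))//.
    rewrite mulrAC (le_trans (ler_wpM2r (ltW ts) c2))//.
    have -> : K * (t - s) * (d / 2 - t) * (d / 2) =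
      (f d - f (d / 2)) * (t - s) * (d / 2 - t).
      by rewrite /K; field; lra.
    by rewrite mulrAC.
  have lo : m * (t - s) <= f t - f s.
    have [->|sn0] := eqVneq s 0; first by rewrite subr0; apply: Hm; lra.
    have s1 : 0 < s by rewrite lt_def sn0.
    have c1 : (f s - f 0) * (t - s) <= (f t - f s) * s.
      have := @cf 0 s t; lra.
    have /(ler_wpM2r (ltW ts)) c2 : m * s <= f s - f 0 by apply: Hm; lra.
    rewrite -(ler_pM2r s1) (le_trans _ c1)// (le_trans _ c2)//; lra.
  rewrite ler_norml.
  have k1 := ler_wpM2r (ltW ts) (ler_norm K).
  have k2 := ler_wpM2r (ltW ts) (ler_norm (- m)).
  have k3 := mulr_ge0 (normr_ge0 K) (ltW ts).
  have k4 := mulr_ge0 (normr_ge0 m) (ltW ts).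
  by rewrite normrN in k2; apply/andP; split; lra.
right=> M.
have [t [t0 tM]] : exists t, 0 < t < d /\ f t - f 0 < - M * t.
  apply: contrapT => H; apply: nm; exists (- M) => t td; rewrite leNgt.
  by apply/negP => lt; apply: H; exists t.
exists t; split; [lra|lra|] => u /andP[u0 ut].
have tt : 0 < t by lra.
have c : f u * (t - 0) <= f 0 * (t - u) + f t * (u - 0) by apply: cf; lra.
by rewrite -(ler_pM2r tt); have := ler_wpM2r (ltW u0) (ltW tM); lra.
Qed.

(** The function [G] has derivative [df u - df 0 + M * u], which is nonpositive for [0 < u < d], so
    the mean value theorem gives [G t <= G 0]. *)
Lemma quadratic_upper_bound (R : realType) (f df : R -> R) (d M : R) :
  (forall t : R, `|t| < d -> is_derive t 1 f (df t)) ->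
  (forall t, 0 < t < d -> df t - df 0 <= - M * t) ->
  forall t, 0 < t < d -> f t - f 0 - df 0 * t <= - (M / 2 * t ^+ 2).
Proof.
move=> fd H t /andP[t0 td].
pose G u := f u - df 0 * u + M / 2 * u ^+ 2.
have dG (u : R) : `|u| < d -> is_derive u 1 G (df u - df 0 + M * u).
  move=> ud; have := fd u ud => dfu.
  have -> : G = f - (df 0 \*: id) + ((M / 2) \*: (id ^+ 2)).
    by apply/funext => v; rewrite /G /= !fctE.
  by apply: is_derive_eq; rewrite /= /GRing.scale /=; field.
have [||c] := @MVT R G (fun u => df u - df 0 + M * u) 0 t t0.
- by move=> x; rewrite in_itv /= => /andP[x0 xt]; apply: dG; rewrite gtr0_norm; lra.
- apply: continuous_itvcc => x /andP[x0 xt].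
  apply: differentiable_continuous; apply/derivable1_diffP.
  by have [] := dG x; rewrite // ger0_norm//; lra.
rewrite in_itv /= => /andP[c0 ct] E.
have le : df c - df 0 + M * c <= 0 by have := H c; lra.
have := mulr_le0_ge0 le (ltW t0); rewrite -[t in X in X -> _]subr0 -E /G; lra.
Qed.

Lemma definable_C1_lipschitz_or_superquadratic (R : realType) S
    (r : R -> R -> Prop) (f df : R -> R) (d : R) :
  o_minimal_structure S -> @S 2 [set x | r (x 0 0) (x 0 1)] -> 0 < d ->
  (forall t y, `|t| < d -> (r t y <-> y = f t)) ->
  (forall t : R, `|t| < d -> is_derive t 1 f (df t)) ->
  (forall t, `|t| < d -> {for t, continuous df}) ->
  (exists L n, 0 < n /\ forall s t, 0 <= s -> s < t -> t < n ->
     `|df t - df s| <= L * (t - s)) \/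
  (forall M, exists2 n, 0 < n & forall t, 0 < t < n ->
     M * t ^+ 2 <= `|f t - f 0 - df 0 * t|).
Proof.
move=> S_omin Sr d0 rf fd cdf.
have [] := @definable_convex_or_concave R S (derive_rel r) df d S_omin _ d0 _ cdf.
- exact: definable_derive_rel.
- by move=> t y td; apply: derive_relE rf td (fd t td).
move=> e /andP[e0 ed] [] /(convex_upto_lipschitz_or_steep e0).
- move=> [[L [n [n0 _ H]]]|H]; [by left; exists L, n|right=> M].
  (* Integrating a slope bound halves it, hence [2 * M]. *)
  have [n [n0 ne Hn]] := H (2 * M).
  exists n => // t tn.
  have fd' (u : R) : `|u| < n -> is_derive u 1 f (df u) by move=> un; apply: fd; lra.
  have := quadratic_upper_bound fd' Hn tn.
  by rewrite -normrN; have := ler_norm (- (f t - f 0 - df 0 * t)); lra.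
- move=> [[L [n [n0 _ H]]]|H]; [left; exists L, n|right=> M].
    by split=> // s t s0 st tn; have := H s t s0 st tn; rewrite -opprD normrN.
  have [n [n0 ne Hn]] := H (2 * M).
  exists n => // t tn.
  have fd' (u : R) : `|u| < n -> is_derive u 1 (fun t => - f t) (- df u).
    by move=> un; apply: is_deriveN; apply: fd; lra.
  have := quadratic_upper_bound (df := fun t => - df t) fd' Hn tn.
  by have := ler_norm (f t - f 0 - df 0 * t); lra.
Qed.

(** * Local parametrization of curves *)

Lemma derivable_line (R : realType) (V W : normedModType R) (g : V -> W)
    (p e : V) (t v : R) :
  derivable g (p + t *: e) (v *: e) -> derivable (fun t : R => g (p + t *: e)) t v.
Proof.
rewrite /derivable; set g1 := fun h => h^-1 *: _; set g2 := fun h => h^-1 *: _.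
suff -> : g1 = g2 by [].
by apply/funext => h; rewrite /g1 /g2 /= scalerDl addrCA scalerA.
Qed.

Lemma derive_line (R : realType) (V W : normedModType R) (g : V -> W)
    (p e : V) (t v : R) :
  'D_v (fun t : R => g (p + t *: e)) t = 'D_(v *: e) g (p + t *: e).
Proof.
rewrite /derive; set g1 := fun h => h^-1 *: _; set g2 := fun h => h^-1 *: _.
suff -> : g1 = g2 by [].
by apply/funext => h; rewrite /g1 /g2 /= scalerDl addrCA scalerA.
Qed.

Lemma continuous_line (R : realType) (V : normedModType R) (p e : V) :
  continuous (fun t : R => p + t *: e).
Proof. by move=> t; apply: cvgD; [exact: cvg_cst|apply: cvgZl; exact: cvg_id]. Qed.

Lemma Ck1_line (R : realType) (V W : normedModType R) (g : V -> W) (U : set V)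
    (p e : V) (I : set R) :
  Ck 1 U g -> (forall t, I t -> U (p + t *: e)) ->
  Ck 1 I (fun t : R => g (p + t *: e)).
Proof.
move=> [dg cg] IU; split=> [t It|v t It].
  apply/derivable1_diffP/derivable_line/diff_derivable; exact/dg/IU.
have -> : 'D_v (fun t : R => g (p + t *: e)) = fun t => 'D_(v *: e) g (p + t *: e).
  by apply/funext => s; exact: derive_line.
apply: (@continuous_comp _ _ _ (fun t : R => p + t *: e) ('D_(v *: e) g)).
  exact: continuous_line.
by apply: cg; exact: IU.
Qed.

(** Translation by [- a] is a smooth straightening. With [k = 2] this places isolated points of [X]
    in [Reg 2 X]. *)
Lemma submanifold0_singleton (R : realType) n k (a : 'rV[R]_n) :
  submanifold k 0 [set a].
Proof.
have Ckcst l (b : 'rV[R]_n) : Ck l setT (fun _ : 'rV[R]_n => b).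
  elim: l b => [|l IH] b; first by move=> x _; exact: cst_continuous.
  split=> [x _|v]; first exact: differentiable_cst.
  have -> : 'D_v (fun _ : 'rV[R]_n => b) = fun=> 0.
    by apply/funext => x; exact: derive_cst.
  exact: IH.
have Ckshift l (A : set 'rV[R]_n) (b : 'rV[R]_n) : A = setT -> Ck l A (fun y => y + b).
  have db (x : 'rV[R]_n) : differentiable (fun y => y + b) x.
    exact: (differentiableD (f := id) (g := cst b)).
  move=> ->; case: l => [|l]; first by move=> x _; exact: differentiable_continuous.
  split=> [x _|v]; first exact: db.
  have -> : 'D_v (fun y : 'rV[R]_n => y + b) = fun=> v.
    apply/funext => x; rewrite (@deriveD _ _ _ id (cst b))//.
    by rewrite derive_id derive_cst addr0.
  exact: Ckcst.
split=> // x ->; exists setT, (fun y => y - a), (fun y => y + a).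
have im : (fun y : 'rV[R]_n => y - a) @` setT = setT.
  by apply/seteqP; split=> // y _; exists (y + a) => //; rewrite addrK.
split.
- by split; [exact: openT|].
- by rewrite im; exact: openT.
- by split; apply: Ckshift.
- by move=> y _; rewrite subrK.
- move=> y _ /=; split=> [-> i _|h]; first by rewrite subrr mxE.
  by apply/subr0_eq/rowP => i; rewrite h// mxE.
Qed.

Lemma submanifold0_isolated (R : realType) n k (M : set 'rV[R]_n) a :
  submanifold k 0 M -> M a -> \forall x \near a, M x -> x = a.
Proof.
move=> [_ H] Ma; have [V [f [g [[Vo Va] _ _ gf fM]]]] := H a Ma.
near=> x.
have Vx : V x by near: x; exact: open_nbhs_nbhs.
move=> Mx; rewrite -(gf x Vx) -(gf a Va); congr g; apply/rowP => i.
by rewrite (fM x Vx).1// (fM a Va).1.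
Unshelve. all: by end_near. Qed.

(** The curve is the image, under the inverse chart, of the line through [f a] in the first
    direction, and [s] reads the parameter back as the displacement of the first chart
    coordinate. *)
Lemma submanifold1_curve (R : realType) n (M : set 'rV[R]_n) a :
  submanifold 1 1 M -> M a ->
  exists (c dc : R -> 'rV[R]_n) (s : 'rV[R]_n -> R) (r : R),
  [/\ 0 < r /\ c 0 = a,
      forall t, `|t| < r -> M (c t),
      forall (t : R) i, `|t| < r -> is_derive t 1 (fun t => c t 0 i) (dc t 0 i) /\
        {for t, continuous (fun t => dc t 0 i)},
      dc 0 != 0 /\ forall l, tangent_space M a (l *: dc 0)
    & (\forall x \near a, M x -> x = c (s x)) /\
      forall e, 0 < e -> \forall x \near a, `|s x| < e].
Proof.
move=> [n1 H] Ma; have [V [f [g [[Vo Va] fVo [fC gC] gf fM]]]] := H a Ma.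
pose j0 : 'I_n := Ordinal n1.
pose e : 'rV[R]_n := delta_mx 0 j0.
pose c t := g (f a + t *: e); pose dc t := 'D_e g (f a + t *: e).
have ca : c 0 = a by rewrite /c scale0r addr0 gf.
have fVa : (f @` V) (f a) by exists a.
have [r r0 rV] : exists2 r : R, 0 < r & forall t : R, `|t| < r -> (f @` V) (f a + t *: e).
  have : nbhs (0 : R) ((fun t : R => f a + t *: e) @^-1` (f @` V)).
    apply: continuous_line; rewrite scale0r addr0; exact: open_nbhs_nbhs.
  move=> /nbhs_ballP[r r0 H']; exists r => // t tr; apply: H'.
  by rewrite /ball /= sub0r normrN.
have cM (t : R) : `|t| < r -> M (c t).
  move=> /rV[y Vy fy]; rewrite /c -fy gf//; apply/(fM y Vy) => i i1.
  rewrite fy !mxE (fM a Va).1// add0r.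
  by rewrite (_ : i == j0 = false) ?andbF ?mulr0//; apply: contraTF i1 => /eqP->.
have cC : Ck 1 (ball 0 r) c.
  by apply: Ck1_line gC _ => t; rewrite /ball /= sub0r normrN; exact: rV.
have dcE : 'D_1 c = dc by apply/funext => t; rewrite derive_line scale1r.
exists c, dc, (fun x => f x 0 j0 - f a 0 j0), r; split.
- by split.
- exact: cM.
- move=> t i tr; have Bt : ball 0 r t by rewrite /ball /= sub0r normrN.
  have dct : derivable c t 1 by apply/derivable1_diffP; exact: cC.1.
  split.
    apply: DeriveDef; first exact: (derivable_mxP c t 1).1.
    by rewrite -dcE derive_mx// mxE.
  apply: (@continuous_comp _ _ _ dc (fun M : 'rV[R]_n => M 0 i)).
    by rewrite -dcE; exact: cC.2.
  exact: coord_continuous.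
- split.
    (* By the chain rule a zero velocity would make [f \o c] stationary at 0, but near 0 it is the
       line [f a + t *: e]. *)
    apply/eqP => dc0.
    have df : differentiable f (c 0) by rewrite ca; exact: fC.1.
    have dcd : differentiable c 0.
      by apply: cC.1; exact: ballxx.
    have : 'D_1 (f \o c) 0 = 0.
      rewrite deriveE; last exact: differentiable_comp.
      have d0 : 'd c 0 1 = 0 by rewrite -dc0 -dcE; apply/esym; exact: deriveE.
      by rewrite diff_comp//= d0 linear0.
    have -> : 'D_1 (f \o c) 0 = 'D_1 (fun t : R => f a + t *: e) 0.
      apply: near_eq_derive; near=> t.
      have [y Vy fy] : (f @` V) (f a + t *: e).
        apply: rV; near: t; apply/nbhs_ballP; exists r => // t'.
        by rewrite /ball /= sub0r normrN.
      by rewrite /= /c -fy gf.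
    rewrite (derive_line id) derive_id scale1r => /rowP /(_ j0).
    by rewrite !mxE !eqxx => /eqP; rewrite oner_eq0.
  move=> l.
  (* The vector [l *: dc 0] is the velocity of the same curve run at speed [l]; the [+ 1] in the
     radius covers [l = 0]. *)
  have [r' r'0 lr'] : exists2 r', 0 < r' & forall t, `|t| < r' -> `|t * l| < r.
    exists (r / (`|l| + 1)).
      by rewrite divr_gt0// ltr_wpDl.
    move=> t; rewrite ltr_pdivlMr ?ltr_wpDl// normrM mulrDr; have := normr_ge0 t; lra.
  exists r', (fun t => g (f a + t *: (l *: e))).
  have cl t : g (f a + t *: (l *: e)) = c (t * l) by rewrite scalerA.
  split.
  + exact: r'0.
  + apply: Ck1_line gC _ => t; rewrite /ball /= sub0r normrN scalerA => ?.
    exact/rV/lr'.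
  + by move=> t; rewrite /ball /= sub0r normrN cl => ?; exact/cM/lr'.
  + by rewrite cl mul0r.
  + rewrite derive_line scale1r scale0r addr0 /dc scale0r addr0.
    have dgp : differentiable g (f a) by exact: gC.1.
    by rewrite !deriveE// linearZ.
- split.
    near=> x => Mx.
    have Vx : V x by near: x; exact: open_nbhs_nbhs.
    rewrite /c -[LHS]gf//; congr g; apply/rowP => i; rewrite !mxE eqxx /=.
    have [->|ij] := eqVneq i j0; first by rewrite mulr1 addrC subrK.
    have i1 : (1 <= i)%N.
      by rewrite lt0n; apply: contra ij => /eqP i0; apply/eqP; apply: val_inj.
    by rewrite (fM x Vx).1// (fM a Va).1// mulr0 addr0.
  have cfj : {for a, continuous ((fun M : 'rV[R]_n => M 0 j0) \o f)}.
    apply: continuous_comp; last exact: coord_continuous.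
    by apply: differentiable_continuous; exact: fC.1.
  move=> e1 e10; move/cvgrPdist_lt : cfj => /(_ e1 e10).
  by apply: filterS => x; rewrite distrC.
Unshelve. all: by end_near. Qed.

(** Near 0 the derivative stays within [|dk 0| / 2] of [dk 0], hence is nonzero: the mean value
    theorem gives injectivity, the intermediate value theorem surjectivity. *)
Lemma inverse_function1 (R : realType) (k dk : R -> R) (r : R) :
  0 < r -> (forall t : R, `|t| < r -> is_derive t 1 k (dk t)) ->
  (forall t, `|t| < r -> {for t, continuous dk}) -> k 0 = 0 -> dk 0 != 0 ->
  exists (s : R -> R) (p d : R),
  [/\ 0 < p <= r, 0 < d, forall x, `|x| < p -> s (k x) = x,
      forall t, `|t| < d -> `|s t| < p /\ k (s t) = t
    & forall t : R, `|t| < d -> dk (s t) != 0 /\ is_derive t 1 s (dk (s t))^-1].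
Proof.
move=> r0 kd cdk k0 dk0.
have dk0' : 0 < `|dk 0| / 2 by rewrite divr_gt0 ?normr_gt0.
have [p [p0 pr near_dk]] : exists p, [/\ 0 < p, p <= r &
    forall x, `|x| < p -> `|dk 0 - dk x| < `|dk 0| / 2].
  have := cdk 0; rewrite normr0 => /(_ r0) /cvgrPdist_lt /(_ _ dk0').
  move=> /nbhs_ballP[p /= p0 H]; exists (Num.min p r).
  split; rewrite ?lt_min ?p0 ?ge_min ?lexx ?orbT//.
  move=> x; rewrite lt_min => /andP[xp _]; apply: H.
  by rewrite /ball /= sub0r normrN.
have dkx (x : R) : `|x| < p -> dk x != 0.
  move=> /near_dk; apply: contraTneq => ->; rewrite subr0; lra.
have ck x : `|x| < p -> {for x, continuous k}.
  move=> xp; apply: differentiable_continuous; apply/derivable1_diffP.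
  by have [] := kd x (lt_le_trans xp pr).
have mvt x y : - p < x -> x < y -> y < p ->
    exists2 z, `|z| < p & k y - k x = dk z * (y - x).
  move=> px xy yp.
  have [||z] := @MVT R k dk x y xy.
  - by move=> z; rewrite in_itv /= => /andP[? ?]; apply: kd; rewrite ltr_norml; lra.
  - by apply: continuous_itvcc => z zxy; apply: ck; rewrite ltr_norml; lra.
  rewrite in_itv /= => /andP[xz zy] ->; exists z => //; rewrite ltr_norml; lra.
have k_inj x y : `|x| < p -> `|y| < p -> k x = k y -> x = y.
  wlog xy : x y / x <= y.
    move=> W xp yp kxy; have [xy|yx] := leP x y; first exact: W.
    by apply/esym/W => //; exact: ltW.
  rewrite !ltr_norml => /andP[px _] /andP[_ yp] kxy.
  apply/eqP/negPn/negP => xny.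
  have [|z zp] := mvt x y px _ yp; first by rewrite lt_def eq_sym xny.
  rewrite kxy subrr => /esym/eqP; rewrite mulf_eq0 subr_eq0 (negbTE (dkx z zp)) /=.
  by rewrite eq_sym (negbTE xny).
pose s t := xget 0 [set x | `|x| < p /\ k x = t].
(* On either side of 0, [k] moves by more than this amount over a length [p / 2], in opposite
   directions. *)
pose d := `|dk 0| / 2 * (p / 2).
have surj t : `|t| < d -> exists x, `|x| < p /\ k x = t.
  rewrite ltr_norml /d => /andP[t1 t2].
  have [|||z1 z1p] := mvt 0 (p / 2); [lra|lra|lra|].
  have [|||z2 z2p] := mvt (- (p / 2)) 0; [lra|lra|lra|].
  have /ltr_normlP[a1 a2] := near_dk z1 z1p.
  have /ltr_normlP[b1 b2] := near_dk z2 z2p.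
  rewrite !k0 !sub0r opprK subr0 => e2 e1.
  have p2 : 0 < p / 2 by lra.
  have [|||x] := @IVT R k (- (p / 2)) (p / 2) t.
  - lra.
  - by apply: continuous_itvcc => x xp; apply: ck; rewrite ltr_norml; lra.
  - rewrite ge_min le_max e1 (_ : k (- (p / 2)) = - (dk z2 * (p / 2))); last lra.
    have [pos|neg] := ltrP 0 (dk 0).
      rewrite gtr0_norm// in a1 a2 b1 b2 t1 t2.
      have h1 : dk 0 / 2 * (p / 2) <= dk z1 * (p / 2) by rewrite ler_pM2r//; lra.
      have h2 : dk 0 / 2 * (p / 2) <= dk z2 * (p / 2) by rewrite ler_pM2r//; lra.
      by apply/andP; split; apply/orP; [left|right]; lra.
    rewrite ler0_norm// in a1 a2 b1 b2 t1 t2.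
    have h1 : dk z1 * (p / 2) <= dk 0 / 2 * (p / 2) by rewrite ler_pM2r//; lra.
    have h2 : dk z2 * (p / 2) <= dk 0 / 2 * (p / 2) by rewrite ler_pM2r//; lra.
    by apply/andP; split; apply/orP; [right|left]; lra.
  rewrite in_itv /= => /andP[x1 x2] kx; exists x; split=> //.
  rewrite ltr_norml; lra.
have sP t : `|t| < d -> `|s t| < p /\ k (s t) = t.
  by move=> /surj; exact: (@xgetPex _ 0 [set x | `|x| < p /\ k x = t]).
have sK x : `|x| < p -> s (k x) = x.
  move=> xp; have [yp ky] : `|s (k x)| < p /\ k (s (k x)) = k x.
    by apply: (@xgetPex _ 0 [set y | `|y| < p /\ k y = k x]); exists x.
  exact: k_inj.
exists s, p, d; split=> //; [by rewrite p0|by rewrite mulr_gt0// divr_gt0|].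
move=> t /sP[stp kst]; split; first exact: dkx.
rewrite -[t in is_derive t]kst.
have nearp : \forall x \near s t, `|x| < p.
  have : open [set x : R | `|x| < p].
    have -> : [set x : R | `|x| < p] = ball 0 p.
      by apply/seteqP; split=> x; rewrite /ball /= sub0r normrN.
    exact: ball_open.
  by move=> o; apply: open_nbhs_nbhs.
apply: is_derive_inverse.
- by apply: filterS nearp => x; exact: sK.
- by apply: filterS nearp => x; exact: ck.
- by apply: kd; exact: lt_le_trans pr.
- exact: dkx.
Qed.

(** A coordinate [j] with [dc 0 0 j != 0] serves as new parameter. The parameter is then a
    coordinate of the point itself, which makes the parametrization definable although the chart
    need not be. *)
Lemma submanifold1_graph (R : realType) n (M : set 'rV[R]_n) :
  submanifold 1 1 M -> M 0 ->
  exists (j : 'I_n) (g dg : R -> 'rV[R]_n) (d : R),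
  [/\ 0 < d,
      forall t, `|t| < d -> M (g t) /\ g t 0 j = t,
      forall (t : R) i, `|t| < d -> is_derive t 1 (fun t => g t 0 i) (dg t 0 i) /\
        {for t, continuous (fun t => dg t 0 i)},
      \forall x \near (0 : 'rV[R]_n), M x -> x = g (x 0 j)
    & forall l, tangent_space M 0 (l *: dg 0)].
Proof.
move=> Msub M0.
have [c [dc [q [r [[r0 c0] cM cd [dc0 cT] [Mc q0]]]]]] := submanifold1_curve Msub M0.
have [j dcj] : exists j, dc 0 0 j != 0.
  apply: contrapT => H; move/negP: dc0; apply; apply/eqP/rowP => j.
  by rewrite mxE; apply: contrapT => /eqP jn; apply: H; exists j.
have [t tr|t tr|||s [p [d [/andP[p0 pr] d0 sK sP sd]]]] :=
  @inverse_function1 R (fun t => c t 0 j) (fun t => dc t 0 j) r r0.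
- exact: (cd t j tr).1.
- exact: (cd t j tr).2.
- by rewrite c0 mxE.
- exact: dcj.
have s0 : s 0 = 0 by rewrite -[RHS]sK ?normr0// c0 mxE.
exists j, (c \o s), (fun t => (dc (s t) 0 j)^-1 *: dc (s t)), d; split=> //=.
- move=> t /sP[stp cst]; split=> //; apply: cM; exact: lt_le_trans pr.
- move=> t i td; have [stp cst] := sP t td; have [dkn ds] := sd t td.
  have str : `|s t| < r by exact: lt_le_trans pr.
  have cs : {for t, continuous s}.
    by apply: differentiable_continuous; apply/derivable1_diffP; case: ds.
  have cdc l : {for t, continuous (fun t => dc (s t) 0 l)}.
    apply: (@continuous_comp _ _ _ s (fun t => dc t 0 l)) => //.
    exact: (cd (s t) l str).2.
  split.
    have := (cd (s t) i str).1 => dci.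
    rewrite mxE mulrC; exact: (@is_derive1_comp R (fun t => c t 0 i) s t).
  have -> : (fun t => ((dc (s t) 0 j)^-1 *: dc (s t)) 0 i) =
    fun t => (dc (s t) 0 j)^-1 * dc (s t) 0 i by apply/funext => u; rewrite mxE.
  by apply: cvgM; [apply: cvgV => //; exact: cdc|exact: cdc].
- near=> x => Mx.
  have xq : x = c (q x) by move: Mx; near: x.
  have qp : `|q x| < p by near: x; exact: q0.
  by rewrite {2}xq sK.
- by move=> l; rewrite s0 scalerA; exact: cT.
Unshelve. all: by end_near. Qed.

(** * Nearest points of curves with Lipschitz tangent *)

(** A single [K] serves as Lipschitz constant and, inverted, as radius, so that finitely many such
    statements combine by intersecting neighbourhoods of infinity. Points on opposite sides are
    compared through 0. *)
Lemma two_sided_lipschitz (R : realType) (f : R -> R) :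
  (exists L n, 0 < n /\ forall s t, 0 <= s -> s < t -> t < n ->
     `|f t - f s| <= L * (t - s)) ->
  (exists L n, 0 < n /\ forall s t, 0 <= s -> s < t -> t < n ->
     `|f (- t) - f (- s)| <= L * (t - s)) ->
  \forall K \near +oo, forall s t, `|s| < K^-1 -> `|t| < K^-1 ->
    `|f t - f s| <= K * `|t - s|.
Proof.
move=> [L1 [n1 [n10 H1]]] [L2 [n2 [n20 H2]]].
near=> K.
have K0 : 0 < K by near: K; apply: nbhs_pinfty_gt; exact: num_real.
have KL1 : L1 <= K by near: K; apply: nbhs_pinfty_ge; exact: num_real.
have KL2 : L2 <= K by near: K; apply: nbhs_pinfty_ge; exact: num_real.
have Kn1 : K^-1 <= n1.
  by rewrite invf_ple ?posrE//; near: K; apply: nbhs_pinfty_ge; exact: num_real.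
have Kn2 : K^-1 <= n2.
  by rewrite invf_ple ?posrE//; near: K; apply: nbhs_pinfty_ge; exact: num_real.
have G1 s t : 0 <= s -> s <= t -> t < n1 -> `|f t - f s| <= K * (t - s).
  rewrite le_eqVlt => s0; rewrite le_eqVlt => /orP[/eqP->|st] tn.
    by rewrite !subrr normr0 mulr0.
  apply: le_trans (H1 _ _ _ st tn) _; first by rewrite le_eqVlt.
  by rewrite ler_wpM2r// subr_ge0 ltW.
have G2 s t : t <= 0 -> s <= t -> - s < n2 -> `|f t - f s| <= K * (t - s).
  move=> t0; rewrite le_eqVlt => /orP[/eqP->|st] sn.
    by rewrite !subrr normr0 mulr0.
  have := H2 (- t) (- s); rewrite !opprK oppr_ge0 ltrN2 distrC [- s + t]addrC => H.
  apply: le_trans (H t0 st sn) _.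
  by rewrite ler_wpM2r// subr_ge0 ltW.
move=> s t; wlog st : s t / s <= t.
  move=> W sK tK; have [st|/ltW ts] := leP s t; first exact: W.
  by rewrite [leLHS]distrC [X in _ * X]distrC; exact: W.
rewrite !ltr_norml => /andP[s1 s2] /andP[t1 t2].
rewrite (ger0_norm (_ : 0 <= t - s)) ?subr_ge0//.
have [s0|s0] := leP 0 s; first by apply: G1 => //; lra.
have [t0|t0] := leP t 0; first by apply: G2 => //; lra.
have g1 : `|f t - f 0| <= K * (t - 0) by apply: G1; lra.
have g2 : `|f 0 - f s| <= K * (0 - s) by apply: G2; lra.
have := ler_distD (f 0) (f t) (f s); lra.
Unshelve. all: by end_near. Qed.

(** The mean value theorem replaces integration; it yields the constant [L] in place of [L / 2],
    which suffices. *)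
Lemma taylor1_lipschitz (R : realType) (f df : R -> R) (e L s t : R) :
  (forall t : R, `|t| < e -> is_derive t 1 f (df t)) ->
  (forall s t, `|s| < e -> `|t| < e -> `|df t - df s| <= L * `|t - s|) ->
  0 <= L -> `|s| < e -> `|t| < e ->
  `|f t - f s - df s * (t - s)| <= L * (t - s) ^+ 2.
Proof.
move=> fd dfL L0 se te.
have cont x : `|x| < e -> {for x, continuous f}.
  move=> xe; apply: differentiable_continuous; apply/derivable1_diffP.
  by have [] := fd x xe.
have [c [ce cs E]] : exists c, [/\ `|c| < e, `|c - s| <= `|t - s| &
    f t - f s = df c * (t - s)].
  move: se te; rewrite !ltr_norml => /andP[s1 s2] /andP[t1 t2].
  have mvt a b : - e < a -> a < b -> b < e ->
      exists2 c, a < c < b & f b - f a = df c * (b - a).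
    move=> ea ab be; have [||c] := @MVT R f df a b ab.
    - by move=> x; rewrite in_itv /= => /andP[? ?]; apply: fd; rewrite ltr_norml; lra.
    - by apply: continuous_itvcc => x ?; apply: cont; rewrite ltr_norml; lra.
    - by rewrite in_itv /= => ? ?; exists c.
  case: (ltgtP s t) => [st|ts|<-].
  - have [c /andP[c1 c2] E] := mvt s t s1 st t2; exists c; split=> //.
      by rewrite ltr_norml; lra.
    by rewrite !ger0_norm; lra.
  - have [c /andP[c1 c2] E] := mvt t s t1 ts s2; exists c; split=> //.
    + by rewrite ltr_norml; lra.
    + by rewrite !ler0_norm; lra.
    + lra.
  - by exists s; rewrite ltr_norml s1 s2 !subrr mulr0.
rewrite E -mulrBl normrM expr2.
have -> : (t - s) * (t - s) = `|t - s| * `|t - s|.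
  by rewrite -!expr2 real_normK ?num_real.
rewrite mulrA ler_wpM2r//; apply: le_trans (dfL s c se ce) _.
exact: ler_wpM2l.
Qed.

Lemma dotp_ge0 (R : realType) n (u : 'rV[R]_n) : 0 <= dotp u u.
Proof. by apply: sumr_ge0 => i _; rewrite -expr2 sqr_ge0. Qed.

Lemma coord_le_enorm (R : realType) n (u : 'rV[R]_n) i : `|u 0 i| <= enorm u.
Proof.
rewrite -sqrtr_sqr ler_wsqrtr// /dotp (bigD1 i)//= -expr2 lerDl.
by apply: sumr_ge0 => l _; rewrite -expr2 sqr_ge0.
Qed.

Lemma dist_to_le (R : realType) n (X : set 'rV[R]_n) a x :
  X x -> dist_to X a <= enorm (a - x).
Proof.
move=> Xx; apply: ge_inf; last by exists x.
by exists 0 => _ [y _ <-]; exact: sqrtr_ge0.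
Qed.

(* If x = g s and y = g t are both nearest to a, then
   |g t - g s|^2 + 2 <g t - g s, g s - a> = 0, where g s - a is orthogonal to
   g' s; by Taylor the second term is at most a small multiple of (t - s)^2,
   while the first is at least (t - s)^2. *)
Lemma lipschitz_tangent_not_medial (R : realType) n (X : set 'rV[R]_n) j
    (g dg : R -> 'rV[R]_n) (d p L e : R) :
  0 < d -> 0 < p -> 0 < e -> 0 <= L -> X 0 ->
  (forall t, `|t| < d -> X (g t) /\ g t 0 j = t) ->
  (forall (t : R) i, `|t| < d -> is_derive t 1 (fun t => g t 0 i) (dg t 0 i)) ->
  (forall x, X x -> (forall l, `|x 0 l| < p) -> x = g (x 0 j)) ->
  (forall i s t, `|s| < e -> `|t| < e ->
     `|dg t 0 i - dg s 0 i| <= L * `|t - s|) ->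
  ~ closure (medial_axis X) 0.
Proof.
move=> d0 p0 e0 L0 X0 gX gd Xg dgL cl.
pose m := Num.min (Num.min d p) e.
have [md mp me m0] : [/\ m <= d, m <= p, m <= e & 0 < m].
  by rewrite /m !lt_min !ge_min !lexx d0 p0 e0 !orbT.
(* The bound [m / 2] keeps nearest points, which have coordinates below [2 * q], inside the box of
   size [m]; the other bound makes the total Taylor error [2 * n * L * q] smaller than 1. *)
pose q := Num.min (m / 2) (2 * n%:R * L + 1)^-1.
have nL : 0 <= 2 * n%:R * L by rewrite !mulr_ge0.
have q0 : 0 < q by rewrite lt_min divr_gt0// invr_gt0 ltr_wpDl.
have qm : q <= m / 2 by rewrite ge_min lexx.
have qL : q <= (2 * n%:R * L + 1)^-1 by rewrite ge_min lexx orbT.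
have nea : nbhs (0 : 'rV[R]_n) [set a | enorm a < q].
  (* Passage from the sup norm to the Euclidean norm: [n * b^2 < ((n + 1) * b)^2]. *)
  have [b b0 qE] : exists2 b, 0 < b & q = b * (n%:R + 1).
    by exists (q / (n%:R + 1)); rewrite ?divfK// ?gt_eqF ?divr_gt0// ltr_wpDl.
  apply/nbhs_ballP; exists b => // a [_ aq].
  rewrite /enorm /= -[q]gtr0_norm// -sqrtr_sqr ltr_sqrt ?exprn_gt0// qE.
  have le : dotp a a <= n%:R * b ^+ 2.
    have -> : n%:R * b ^+ 2 = \sum_(i < n) b ^+ 2.
      by rewrite sumr_const card_ord mulr_natl.
    apply: ler_sum => i _; have := aq 0 i; rewrite /ball /= mxE sub0r normrN => ai.
    rewrite -expr2 -[a 0 i ^+ 2]real_normK ?num_real//.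
    by rewrite ler_pXn2r ?nnegrE// ?ltW.
  apply: le_lt_trans le _; rewrite exprMn [n%:R * _]mulrC ltr_pM2l ?exprn_gt0//.
  have := ler0n R n; nra.
have [a [[x [y [[Xx ax] [Xy ay] xy]]] /= aq]] := cl _ nea.
(* Since 0 lies in [X], the distance from [a] to [X] is at most [enorm a < q]. *)
have near_a z : X z -> enorm (a - z) = dist_to X a ->
    (forall l, `|a 0 l - z 0 l| <= q) /\ forall l, `|z 0 l| < m.
  move=> Xz az.
  have le l : `|a 0 l - z 0 l| <= q.
    have := coord_le_enorm (a - z) l; rewrite !mxE => h; apply: (le_trans h).
    by rewrite az; apply: le_trans (dist_to_le a X0) _; rewrite subr0 ltW.
  split=> // l; have := le l; have := coord_le_enorm a l.
  have := ler_distD (a 0 l) (z 0 l) 0; rewrite !subr0 distrC; lra.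
have gE z : X z -> enorm (a - z) = dist_to X a -> z = g (z 0 j).
  by move=> Xz /(near_a z Xz)[_ zm]; apply: Xg => // l; exact: lt_le_trans mp.
have [ax' xm] := near_a x Xx ax; have [_ ym] := near_a y Xy ay.
pose s : R := x 0 j; pose t : R := y 0 j.
have xs : x = g s := gE x Xx ax; have yt : y = g t := gE y Xy ay.
have sm : `|s| < m := xm j; have tm : `|t| < m := ym j.
have st : t - s != 0.
  by rewrite subr_eq0; apply/eqP => ts; apply: xy; rewrite xs yt ts.
have sd : `|s| < d by exact: lt_le_trans md.
have td : `|t| < d by exact: lt_le_trans md.
pose h u := \sum_(i < n) (a 0 i - g u 0 i) * (a 0 i - g u 0 i).
have hE u : h u = enorm (a - g u) ^+ 2.
  rewrite /enorm sqr_sqrtr ?dotp_ge0//; apply: eq_bigr => i _; by rewrite !mxE.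
have dh (u : R) : `|u| < d ->
    is_derive u 1 h (\sum_(i < n) 2 * ((g u 0 i - a 0 i) * dg u 0 i)).
  move=> ud; have -> : h = \sum_(i < n) (fun u => (a 0 i - g u 0 i) * (a 0 i - g u 0 i)).
    by apply/funext => v; rewrite fct_sumE.
  apply: is_derive_sum => i.
  have gi := gd u i ud.
  have dk : is_derive u 1 (fun u => a 0 i - g u 0 i) (- dg u 0 i).
    by have := is_deriveB (is_derive_cst (a 0 i) u 1) gi; rewrite sub0r.
  apply: (is_derive_eq (is_deriveM dk dk)).
  by rewrite /GRing.scale /=; ring.
have h0 : \sum_(i < n) 2 * ((g s 0 i - a 0 i) * dg s 0 i) = 0.
  have dd : - d <= d by lra.
  have sI : s \in `]- d, d[ by rewrite in_itv /= -ltr_norml.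
  have [||] := @derive1_at_min R h (- d) d s dd _ sI.
  - move=> u; rewrite in_itv /= -ltr_norml => ud; by have [] := dh u ud.
  - move=> u; rewrite in_itv /= -ltr_norml => ud; rewrite !hE -xs ax.
    rewrite ler_pXn2r ?nnegrE ?sqrtr_ge0//.
      by apply: dist_to_le; case: (gX u ud).
    by rewrite -ax sqrtr_ge0.
  - by move=> _ Dh; have [_ <-] := dh s sd.
have hst : h t = h s by rewrite !hE -xs -yt ax ay.
have : \sum_(i < n) ((g t 0 i - g s 0 i) ^+ 2 +
    2 * ((g t 0 i - g s 0 i - dg s 0 i * (t - s)) * (g s 0 i - a 0 i))) = 0.
  transitivity (h t - h s - (t - s) * \sum_(i < n) 2 * ((g s 0 i - a 0 i) * dg s 0 i)).
    by rewrite mulr_sumr -!sumrB; apply: eq_bigr => i _; ring.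
  by rewrite h0 hst subrr mulr0 subr0.
(* Coordinate [j] alone supplies [(t - s) ^+ 2], because [g t 0 j = t]; every coordinate may
   contribute a Taylor error. *)
have lower i : (i == j)%:R * (t - s) ^+ 2 - 2 * (L * (t - s) ^+ 2 * q) <=
    (g t 0 i - g s 0 i) ^+ 2 +
    2 * ((g t 0 i - g s 0 i - dg s 0 i * (t - s)) * (g s 0 i - a 0 i)).
  apply: lerD.
    have [->|_] := eqVneq i j; last by rewrite mul0r sqr_ge0.
    by rewrite mul1r (gX t td).2 (gX s sd).2.
  have T : `|g t 0 i - g s 0 i - dg s 0 i * (t - s)| <= L * (t - s) ^+ 2.
    apply: (@taylor1_lipschitz R (fun t => g t 0 i) (fun t => dg t 0 i) m) => //.
      by move=> u um; apply: gd; exact: lt_le_trans md.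
    by move=> u v um vm; apply: dgL; exact: lt_le_trans me.
  have A : `|g s 0 i - a 0 i| <= q by rewrite distrC -xs.
  have := ler_norm (- ((g t 0 i - g s 0 i - dg s 0 i * (t - s)) * (g s 0 i - a 0 i))).
  rewrite normrN normrM.
  have := ler_pM (normr_ge0 _) (normr_ge0 _) T A; lra.
move=> sum0.
have : \sum_(i < n) ((i == j)%:R * (t - s) ^+ 2 - 2 * (L * (t - s) ^+ 2 * q)) <= 0.
  by rewrite -[leRHS]sum0; apply: ler_sum => i _; exact: lower.
rewrite sumrB -mulr_suml sumr_const card_ord (bigD1 j)//= eqxx big1 ?addr0;
  last by move=> i /negbTE->.
have ts2 : 0 < (t - s) ^+ 2 by rewrite exprn_even_gt0 ?orbT.
rewrite -[_ *+ n]mulr_natl mulr1n mul1r => le.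
have : q * (2 * n%:R * L + 1) <= 1.
  have := ler_wpM2r (_ : 0 <= 2 * n%:R * L + 1) qL.
  by rewrite mulVf ?gt_eqF ?ltr_wpDl//; apply; lra.
move=> /(ler_wpM2r (ltW ts2)).
have := mulr_gt0 q0 ts2; lra.
Qed.

(** * The gap between a curve and its tangent *)

Section TangentGap.
Variables (R : realType) (n : nat) (X : set 'rV[R]_n) (j : 'I_n).
Variables (g : R -> 'rV[R]_n) (w : 'rV[R]_n) (d : R).
Hypothesis d_gt0 : 0 < d.
Hypothesis g0 : g 0 = 0.
Hypothesis gX : forall t, `|t| < d -> X (g t) /\ g t 0 j = t.
Hypothesis cg : forall (t : R) i, `|t| < d -> {for t, continuous (fun t => g t 0 i)}.
Hypothesis dg : forall i, is_derive (0 : R) 1 (fun t => g t 0 i) (w 0 i).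
Hypothesis Xg : \forall x \near (0 : 'rV[R]_n), X x -> x = g (x 0 j).
Hypothesis Tw : forall l, tangent_space X 0 (l *: w).

Lemma tangent_vector_coord : w 0 j = 1.
Proof.
have [_ <-] := dg j.
rewrite -[RHS](@derive_id R R 0 1); apply: near_eq_derive.
apply/nbhs_ballP; exists d => // t.
by rewrite /ball /= sub0r normrN => td; exact: (gX td).2.
Qed.

(** A curve in [X] through 0 satisfies [c t = g (c t 0 j)] near 0, so the chain rule makes its
    velocity a multiple of [w]. *)
Lemma tangent_spaceE v : tangent_space X 0 v <-> exists l, v = l *: w.
Proof.
split=> [[e [c [e0 [cd _] cX c0 <-]]]|[l ->]]; last exact: Tw.
have c00 : ball (0 : R) e 0 by exact: ballxx.
have dc : derivable c (0 : R) 1 by apply/derivable1_diffP; exact: cd.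
have dci i : is_derive (0 : R) 1 (fun t => c t 0 i) ('D_1 c 0 0 i).
  apply: DeriveDef; first exact: (derivable_mxP c 0 1).1.
  by rewrite derive_mx// mxE.
have cc : {for 0, continuous c} by apply: differentiable_continuous; exact: cd.
have cg' : \forall t \near (0 : R), c t = g (c t 0 j).
  have : \forall t \near (0 : R), X (c t) -> c t = g (c t 0 j).
    by have := cc [set x | X x -> x = g (x 0 j)]; rewrite /= c0; apply.
  have : \forall t \near (0 : R), X (c t).
    by apply/nbhs_ballP; exists e => // t; exact: cX.
  by apply: filterS2 => t Xc; apply.
exists ('D_1 c 0 0 j); apply/rowP => i; rewrite mxE mulrC.
have [_ <-] := dci i.
have -> : 'D_1 (fun t => c t 0 i) 0 = 'D_1 (fun t => g (c t 0 j) 0 i) 0.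
  by apply: near_eq_derive; apply: filterS cg' => t <-.
have dgi : is_derive (c 0 0 j) 1 (fun t => g t 0 i) (w 0 i).
  by rewrite c0 mxE; exact: dg.
by have [_ <-] := @is_derive1_comp R (fun t => g t 0 i) (fun t => c t 0 j) 0 _ _
  dgi (dci j).
Qed.

Let W := dotp w w.

Lemma dotp_tangent_gt0 : 0 < W.
Proof.
rewrite /W /dotp (bigD1 j)//= tangent_vector_coord mulr1 ltr_wpDr//.
by apply: sumr_ge0 => i _; rewrite -expr2 sqr_ge0.
Qed.

Lemma dotp_subZ (x : 'rV[R]_n) k :
  dotp (x - k *: w) (x - k *: w) = dotp x x - 2 * k * dotp x w + k ^+ 2 * W.
Proof.
rewrite /W /dotp !mulr_sumr -sumrB -big_split /=; apply: eq_bigr => i _.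
by rewrite !mxE; ring.
Qed.

(** The projection is picked by [xget], so a projection must be shown to exist before its properties
    can be used; orthogonality to [w] then determines its coefficient. *)
Lemma tangent_projE x : tangent_proj X 0 x = (dotp x w / W) *: w.
Proof.
have W0 := dotp_tangent_gt0.
have dotpB (k l : R) : dotp (x - k *: w) (l *: w) = l * (dotp x w - k * W).
  rewrite /W /dotp mulr_sumr -sumrB mulr_sumr; apply: eq_bigr => i _.
  by rewrite !mxE; ring.
have [|Tq orth] := @xgetPex _ 0 [set q | tangent_space X 0 (q - 0) /\
    forall v, tangent_space X 0 v -> dotp (x - q) v = 0].
  exists ((dotp x w / W) *: w); split; first by rewrite subr0.
  move=> v /tangent_spaceE[l ->]; rewrite dotpB; field; lra.
rewrite /tangent_proj; move: Tq orth; set q := xget _ _.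
rewrite subr0 => /tangent_spaceE[k ->] /(_ (1 *: w)) /(_ (Tw 1)).
rewrite dotpB mul1r => kW; congr (_ *: _).
by rewrite (subr0_eq kW) mulfK// gt_eqF.
Qed.

Lemma enorm_tangent_proj x :
  enorm (tangent_proj X 0 x) ^+ 2 = dotp x w ^+ 2 / W.
Proof.
have W0 := dotp_tangent_gt0.
rewrite /enorm sqr_sqrtr ?dotp_ge0// tangent_projE.
have -> k : dotp (k *: w) (k *: w) = k ^+ 2 * W.
  by rewrite /W /dotp mulr_sumr; apply: eq_bigr => i _; rewrite !mxE; ring.
by field; lra.
Qed.

Lemma pythagoras_tangent_proj x :
  enorm (x - tangent_proj X 0 x) ^+ 2 + enorm (tangent_proj X 0 x) ^+ 2 = dotp x x.
Proof.
have W0 := dotp_tangent_gt0.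
rewrite enorm_tangent_proj /enorm sqr_sqrtr ?dotp_ge0// tangent_projE dotp_subZ.
by field; lra.
Qed.

(** Distances to the tangent are at most [enorm y <= r] by Pythagoras, so the supremum is over a
    bounded set and dominates each of its elements. *)
Lemma tangent_gap_ge x r : X x -> enorm x <= r ->
  enorm (x - tangent_proj X 0 x) <= tangent_gap X 0 r (enorm (tangent_proj X 0 x)).
Proof.
move=> Xx xr; apply: ub_le_sup; last by exists x => //=; rewrite !subr0.
exists r => _ [y [Xy yr _] <-]; rewrite subr0 in yr; apply: le_trans yr.
rewrite /enorm ler_wsqrtr// -(pythagoras_tangent_proj y).
by rewrite -[leLHS]sqr_sqrtr ?dotp_ge0// -/(enorm _) lerDl sqr_ge0.
Qed.

(* The linear map y |-> y - y_j w kills w, so it does not see the projection. *)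
Lemma offset_le_tangent_dist (x : 'rV[R]_n) i :
  `|x 0 i - w 0 i * x 0 j| <= (1 + `|w 0 i|) * enorm (x - tangent_proj X 0 x).
Proof.
rewrite tangent_projE; set k := _ / _; set y := x - _.
have -> : x 0 i - w 0 i * x 0 j = y 0 i - w 0 i * y 0 j.
  by rewrite /y !mxE tangent_vector_coord; ring.
apply: le_trans (ler_normB _ _) _; rewrite normrM mulrDl mul1r lerD//.
  exact: coord_le_enorm.
by rewrite ler_wpM2l// coord_le_enorm.
Qed.

Lemma continuous_dotp_curve t : `|t| < d -> {for t, continuous (fun t => dotp (g t) w)}.
Proof.
move=> td; have -> : (fun t => dotp (g t) w) = \sum_(i < n) (fun t => g t 0 i * w 0 i).
  by apply/funext => u; rewrite fct_sumE.
elim/big_ind: _ => [|f1 f2 c1 c2|i _]; first exact: cst_continuous.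
  exact: continuousD.
by apply: cvgM; [exact: cg|exact: cvg_cst].
Qed.

Lemma near_tangent e : 0 < e ->
  \forall t \near (0 : R), forall i, `|g t 0 i - w 0 i * t| <= e * `|t|.
Proof.
move=> e0.
near=> t => i; move: i; near: t; apply: filter_forall => /= i.
have [p p0 H] := is_derive1_eps (dg i) e0.
apply/nbhs_ballP; exists p => // t; rewrite /ball /= sub0r normrN => tp.
by have := H t tp; rewrite add0r g0 mxE subr0.
Unshelve. all: by end_near. Qed.

(** One curve point whose projection has norm exactly [e] bounds the gap from below; the
    intermediate value theorem finds it on the side chosen by the sign [s]. Since
    [e ^+ 2 <= C * t ^+ 2], growth against [t ^+ 2] becomes growth against [e ^+ 2]. *)
Lemma superquadratic_of_coord i (s : R) : `|s| = 1 ->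
  (forall M, exists2 p, 0 < p & forall t, 0 < t < p ->
    M * t ^+ 2 <= `|g (s * t) 0 i - w 0 i * (s * t)|) ->
  superquadratic X 0.
Proof.
move=> s1 H; have W0 := dotp_tangent_gt0.
(* This precision keeps [dotp (g t) w] within [W / 2 * |t|] of [W * t], hence nonzero for
   [t != 0]. *)
pose e1 := W / (2 * (\sum_(l < n) `|w 0 l| + 1)).
have sw : 0 < \sum_(l < n) `|w 0 l| + 1 by rewrite ltr_wpDl// sumr_ge0.
have e10 : 0 < e1 by rewrite divr_gt0// mulr_gt0.
have [p1 /= p10 Hp1] := (nbhs_ballP _ _).1 (near_tangent e10).
have {}Hp1 t : `|t| < p1 -> forall l, `|g t 0 l - w 0 l * t| <= e1 * `|t|.
  by move=> tp; apply: Hp1; rewrite /ball /= sub0r normrN.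
pose C := \sum_(l < n) (e1 + `|w 0 l|) ^+ 2.
have C0 : 0 <= C by apply: sumr_ge0 => l _; exact: sqr_ge0.
have gC t : `|t| < p1 -> dotp (g t) (g t) <= C * t ^+ 2.
  move=> tp; rewrite /C mulr_suml; apply: ler_sum => l _.
  rewrite -expr2 -[g t 0 l ^+ 2]real_normK ?num_real//.
  rewrite -[t ^+ 2]real_normK ?num_real// -exprMn.
  have nn : 0 <= (e1 + `|w 0 l|) * `|t| by rewrite mulr_ge0// addr_ge0// ltW.
  rewrite ler_pXn2r ?nnegrE//.
  have := Hp1 t tp l; have := ler_normD (g t 0 l - w 0 l * t) (w 0 l * t).
  by rewrite subrK normrM; lra.
have gW t : `|t| < p1 -> t != 0 -> dotp (g t) w != 0.
  move=> tp t0.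
  have : `|dotp (g t) w - W * t| <= W / 2 * `|t|.
    have -> : dotp (g t) w - W * t = \sum_(l < n) (g t 0 l - w 0 l * t) * w 0 l.
      by rewrite /W /dotp mulr_suml -sumrB; apply: eq_bigr => l _; ring.
    apply: le_trans (ler_norm_sum _ _ _) _.
    apply: (@le_trans _ _ (\sum_(l < n) e1 * `|t| * `|w 0 l|)).
      by apply: ler_sum => l _; rewrite normrM ler_wpM2r// Hp1.
    rewrite -mulr_sumr.
    have -> : W / 2 = e1 * (\sum_(l < n) `|w 0 l| + 1) by rewrite /e1; field; lra.
    have := mulr_ge0 (ltW e10) (normr_ge0 t); lra.
  apply: contraTneq => ->; rewrite sub0r normrN normrM (gtr0_norm W0) -ltNge.
  by rewrite ltr_pM2r ?normr_gt0//; lra.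
near=> r; have r0 : 0 < r by near: r; exact: nbhs_right_gt.
apply/cvgryPge => M.
(* The factor [C] pays for replacing [t ^+ 2] by [e ^+ 2], and [1 + |w_i|] is the loss in
   [offset_le_tangent_dist]. *)
pose M' := `|M| * C * (1 + `|w 0 i|).
have [p2 p20 Hp2] := H M'.
(* The bound [r / (C + 1)] keeps [g (s * t)] in the ball of radius [r], as its squared norm is at
   most [C * t ^+ 2 <= ((C + 1) * t) ^+ 2]. *)
pose q := Num.min (Num.min p1 p2) (Num.min d (r / (C + 1))).
have [qp1 qp2 qd qr q0] : [/\ q <= p1, q <= p2, q <= d, q <= r / (C + 1) & 0 < q].
  by rewrite /q !lt_min !ge_min !lexx p10 p20 d_gt0 divr_gt0 ?ltr_wpDl ?orbT.
pose t0 := q / 2.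
have [t00 t0q] : 0 < t0 /\ t0 < q by rewrite /t0; split; lra.
have normst t : 0 <= t -> `|s * t| = t by move=> ?; rewrite normrM s1 mul1r ger0_norm.
pose h t := enorm (tangent_proj X 0 (g (s * t))).
have hE t : h t = `|dotp (g (s * t)) w| / Num.sqrt W.
  have nn : 0 <= `|dotp (g (s * t)) w| / Num.sqrt W by rewrite divr_ge0 ?sqrtr_ge0.
  apply/eqP; rewrite -(@eqrXn2 _ 2) ?nn ?sqrtr_ge0//; apply/eqP.
  rewrite /h enorm_tangent_proj exprMn exprVn sqr_sqrtr ?ltW//.
  by rewrite real_normK ?num_real.
have ch : {within `[0, t0], continuous h}.
  have -> : h = fun t => `|dotp (g (s * t)) w| / Num.sqrt W by apply/funext.
  apply: continuous_itvcc => t /andP[t1 t2].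
  have td : `|s * t| < d by rewrite normst//; lra.
  apply: cvgM; last exact: cvg_cst.
  apply: cvg_norm.
  apply: (@continuous_comp _ _ _ (fun t => s * t) (fun t => dotp (g t) w)).
    by apply: cvgM; [exact: cvg_cst|exact: cvg_id].
  exact: continuous_dotp_curve.
have h0 : h 0 = 0.
  rewrite hE mulr0 g0 (_ : dotp 0 w = 0) ?normr0 ?mul0r//.
  by rewrite /dotp big1// => l _; rewrite mxE mul0r.
have ht0 : 0 < h t0.
  rewrite hE divr_gt0 ?sqrtr_gt0// normr_gt0; apply: gW.
    by rewrite normst; lra.
  by rewrite -normr_gt0 normst ?ltW.
near=> e.
have e0 : 0 < e by near: e; exact: nbhs_right_gt.
have et0 : e < h t0 by near: e; exact: nbhs_right_lt.
have [|t] := @IVT R h 0 t0 e (ltW t00) ch.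
  by rewrite h0 ge_min le_max (ltW e0) (ltW et0) orbT.
rewrite in_itv /= => /andP[t1 t2] hte.
have tpos : 0 < t.
  by rewrite lt_def t1 andbT; apply: contraTneq e0 => t_0; rewrite -hte t_0 h0 ltxx.
have std : `|s * t| < d by rewrite normst//; lra.
have stp1 : `|s * t| < p1 by rewrite normst//; lra.
have [Xgt gtj] := gX std.
set x := g (s * t) in Xgt gtj.
have st2 : (s * t) ^+ 2 = t ^+ 2.
  by rewrite -[LHS]real_normK ?num_real// normst.
have xC : dotp x x <= C * t ^+ 2 by rewrite -st2; exact: gC.
have xr : enorm x <= r.
  rewrite /enorm -[r]gtr0_norm// -sqrtr_sqr ler_wsqrtr//.
  apply: le_trans xC _.
  have C1 : 0 < C + 1 by lra.
  have tr : t * (C + 1) <= r by rewrite -ler_pdivlMr//; lra.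
  apply: (@le_trans _ _ ((t * (C + 1)) ^+ 2)).
    by rewrite exprMn mulrC ler_wpM2l ?sqr_ge0//; nra.
  have nn : 0 <= t * (C + 1) by rewrite mulr_ge0 ?ltW.
  by rewrite ler_pXn2r ?nnegrE ?(ltW r0).
have e2 : e ^+ 2 <= C * t ^+ 2.
  apply: le_trans xC; rewrite -hte -pythagoras_tangent_proj.
  by rewrite /h -/x lerDr sqr_ge0.
have dist : `|M| * C * t ^+ 2 <= enorm (x - tangent_proj X 0 x).
  have w1 : 0 < 1 + `|w 0 i| by rewrite ltr_pwDl.
  rewrite -(ler_pM2l w1); apply: le_trans (offset_le_tangent_dist x i).
  rewrite gtj; have := Hp2 t; rewrite /M' => le.
  have tp2 : 0 < t < p2 by lra.
  by have := le tp2; lra.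
have gap := tangent_gap_ge Xgt xr.
rewrite -/(h t) hte in gap.
rewrite ler_pdivlMr ?exprn_gt0//; apply: le_trans gap; apply: le_trans dist.
rewrite -mulrA; apply: (@le_trans _ _ (`|M| * e ^+ 2)).
  by rewrite ler_wpM2r ?sqr_ge0// ler_norm.
by rewrite ler_wpM2l.
Unshelve. all: by end_near. Qed.

End TangentGap.

(** * Reduction to a one-dimensional submanifold and conclusion *)

(** Local dimension 0 is the case to exclude: [a] would be isolated in [X], hence a point of
    [Reg 2 X]. *)
Lemma Sng2_submanifold1 (R : realType) n (X : set 'rV[R]_n) a :
  has_dim X 1 -> (Sng 2 X `&` Reg 1 X) a ->
  exists2 U, nbhs a U & submanifold 1 1 (X `&` U).
Proof.
move=> [_ dimX] [[Xa nreg] [_ [U [k [Ua Usub]]]]].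
exists U => //; have XUa : (X `&` U) a by split=> //; exact: nbhs_singleton.
have : (k <= 1)%N by apply: dimX Usub; [exact: subIsetl|exists a].
case: k Usub => [|[|//]] // Usub _; exfalso; apply: nreg; split=> //.
exists (U `&` [set x | (X `&` U) x -> x = a]), 0; split.
  by apply: filterI => //; exact: submanifold0_isolated Usub XUa.
rewrite (_ : _ `&` _ = [set a]); first exact: submanifold0_singleton.
apply/seteqP; split=> x /=; first by move=> [Xx [Ux]]; apply.
by move=> ->; split=> //; split=> //; exact: nbhs_singleton.
Qed.

Lemma continuous_near_box (R : realType) n (g : R -> 'rV[R]_n) (p : R) :
  0 < p -> g 0 = 0 -> (forall i, {for 0, continuous (fun t => g t 0 i)}) ->
  \forall t \near (0 : R), forall i, `|g t 0 i| < p.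
Proof.
move=> p0 g0 cg; near=> t => i; move: i; near: t; apply: filter_forall => /= i.
have := cg i; rewrite /continuous_at => /cvgrPdist_lt /(_ p p0).
by apply: filterS => t; rewrite g0 mxE sub0r normrN.
Unshelve. all: by end_near. Qed.

Unset Implicit Arguments.

Theorem theorem3p8 (R : realType) (S : forall n : nat, set (set 'rV[R]_n))
    (S_omin : o_minimal_structure S)
    (n : nat) (X : set 'rV[R]_n)
    (X_closed : closed X) (X_definable : S n X) (X_dim1 : has_dim X 1)
    (X_sng : (Sng 2 X `&` Reg 1 X) 0) :
  closure (medial_axis X) 0 -> SQ X 0.
Proof.
move=> cl; split=> //; have X0 : X 0 by have [[]] := X_sng.
have [U U0 /submanifold1_graph] := Sng2_submanifold1 X_dim1 X_sng.
move=> [|j [g [dg [d [d0 gM gd Mg Tg]]]]]; first by split=> //; exact: nbhs_singleton.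
have Xg : \forall x \near (0 : 'rV[R]_n), X x -> x = g (x 0 j).
  by apply: filterS2 U0 Mg => x Ux H Xx; apply: H.
have gX t : `|t| < d -> X (g t) /\ g t 0 j = t by move=> /gM[[? _] ?].
have Tw l : tangent_space X 0 (l *: dg 0).
  have [e [c [e0 cC cM c0 Dc]]] := Tg l; exists e, c; split=> // t /cM[] //.
have g0 : g 0 = 0.
  by have := nbhs_singleton Xg X0; rewrite mxE.
have cg (t : R) i : `|t| < d -> {for t, continuous (fun t => g t 0 i)}.
  move=> td; apply: differentiable_continuous; apply/derivable1_diffP.
  by have [[]] := gd t i td.
have z0 : `|0 : R| < d by rewrite normr0.
have dg0 i : is_derive (0 : R) 1 (fun t => g t 0 i) (dg 0 0 i) := (gd 0 i z0).1.
have SQ_of_coord := superquadratic_of_coord d0 g0 gX cg dg0 Xg Tw.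
have [p p0 Xgp] : exists2 p, 0 < p &
    forall x, X x -> (forall l, `|x 0 l| < p) -> x = g (x 0 j).
  have /nbhs_ballP[p /= p0 H] := Xg; exists p => // x Xx xp; apply: H => //.
  by split=> // k l; rewrite /ball /= ord1 mxE sub0r normrN.
have [d1 d10 gp] : exists2 d1, 0 < d1 <= d &
    forall t, `|t| < d1 -> forall i, `|g t 0 i| < p.
  have /nbhs_ballP[d1 /= d10 H] := continuous_near_box p0 g0 (fun i => cg 0 i z0).
  exists (Num.min d1 d); first by rewrite lt_min d10 d0 ge_min lexx orbT.
  move=> t; rewrite lt_min => /andP[td _]; apply: H.
  by rewrite /ball /= sub0r normrN.
have /andP[d1_gt0 d1d] := d10.
(* Over [|t| < d1] this is exactly the graph of [g_i]: the box of size [p] forces [x = g (x 0 j)],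
   and [d1] keeps [g t] inside the box. *)
pose r i t y := exists x, [/\ X x, forall l, `|x 0 l| < p, x 0 j = t & x 0 i = y].
have rE i t y : `|t| < d1 -> (r i t y <-> y = g t 0 i).
  move=> td; split=> [[x [Xx xp <- <-]]|->].
    exact: (congr1 (fun z : 'rV[R]_n => z 0 i) (Xgp x Xx xp)).
  have [Xgt gtj] := gX t (lt_le_trans td d1d).
  by exists (g t); split=> //; exact: gp.
have Sr i : S 2 [set x | r i (x 0 0) (x 0 1)] by exact: definable_coord_image.
have [noLip|Lip] := pselect (exists i, ~ \forall K \near +oo, forall s t,
    `|s| < K^-1 -> `|t| < K^-1 -> `|dg t 0 i - dg s 0 i| <= K * `|t - s|).
  have {noLip}[i noLip] := noLip.
  have opp_lt (t : R) : `|t| < d1 -> `|- t| < d by rewrite normrN => /lt_le_trans; apply.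
  have [lip1|sq1] := @definable_C1_lipschitz_or_superquadratic R S (r i)
    (fun t => g t 0 i) (fun t => dg t 0 i) d1 S_omin (Sr i) d1_gt0 (rE i)
    (fun t td => (gd t i (lt_le_trans td d1d)).1)
    (fun t td => (gd t i (lt_le_trans td d1d)).2); last first.
    apply: (SQ_of_coord i 1); first by rewrite normr1.
    move=> M; have [q q0 H] := sq1 M; exists q => // t tq; rewrite mul1r.
    by have := H t tq; rewrite g0 mxE subr0.
  (* The left side of 0 is treated as the right side for [g (- t)], whose derivative is
     [- dg (- t)]. *)
  have [|||lip2|sq2] := @definable_C1_lipschitz_or_superquadratic R S
    (fun t => r i (- t)) (fun t => g (- t) 0 i) (fun t => - dg (- t) 0 i) d1
    S_omin (definable_reflect S_omin (Sr i)) d1_gt0.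
  - by move=> t y td; apply: rE; rewrite normrN.
  - move=> t /opp_lt td; have dgi := (gd _ i td).1.
    rewrite -mulrN1.
    exact: (@is_derive1_comp R (fun t => g t 0 i) (fun t => - t) t _ _ dgi).
  - move=> t /opp_lt td; apply: cvgN.
    apply: (@continuous_comp _ _ _ (fun t => - t) (fun t => dg t 0 i)).
      by apply: cvgN; exact: cvg_id.
    exact: (gd _ i td).2.
  - exfalso; apply: noLip; apply: (@two_sided_lipschitz R (fun t => dg t 0 i)) => //.
    have [L [q [q0 H]]] := lip2; exists L, q; split=> // s t s0 st tq.
    by apply: le_trans (H s t s0 st tq); rewrite -opprD normrN.
  apply: (SQ_of_coord i (-1)); first by rewrite normrN normr1.
  move=> M; have [q q0 H] := sq2 M; exists q => // t tq; rewrite mulN1r.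
  by have := H t tq; rewrite oppr0 g0 mxE subr0 mulNr mulrN.
exfalso.
(* The coordinates are finitely many, so one [K] near infinity serves them all. *)
have [K [K0 HK]] : exists K, 0 < K /\ forall i s t,
    `|s| < K^-1 -> `|t| < K^-1 -> `|dg t 0 i - dg s 0 i| <= K * `|t - s|.
  have H : \forall K \near +oo, forall i s t,
      `|s| < K^-1 -> `|t| < K^-1 -> `|dg t 0 i - dg s 0 i| <= K * `|t - s|.
    near=> K => i; move: i; near: K; apply: filter_forall => /= i.
    by apply: contrapT => nH; apply: Lip; exists i.
  near (pinfty_nbhs R) => K; exists K; split.
    by near: K; apply: nbhs_pinfty_gt; exact: num_real.
  by near: K.
apply: (@lipschitz_tangent_not_medial R n X j g dg d p K K^-1) => //.
- by rewrite invr_gt0.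
- exact: ltW.
- by move=> t i td; exact: (gd t i td).1.
Unshelve. all: by end_near. Qed.
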